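(* Consider the families of genus 3 curves $Z_k$ defined by any one of the following (each choice of sign giving one family): (i) $y^2+\bigl(x^5+1+k(x^4+x)+(-k-1\pm1)(x^3+x^2)\bigr)y+x^5=0$, (ii) $y^2+\bigl(x^6+1+k(x^5+x)-(x^4+x^2)+(-2k+2)x^3\bigr)y+x^6=0$, (iii) $y^2+\bigl(x^6+1+k(x^5+x)-(1\pm1)(x^4+x^2)-2kx^3\bigr)y+x^6=0$. Then the elements $\{x,y\}$, $\{x-1,y\}$, $\{x+1,y\}$ are in $K_2^T(Z_k)\otimes\mathbb{Q}$. Moreover, for $|k|\gg0$ (i.e. for all $k\in\mathbb{C}$ with $|k|$ larger than some constant) these three elements are linearly independent over $\mathbb{Q}$.
   Context: $k$ is a complex parameter for which the defining polynomial is absolutely irreducible and the curve has genus 3. The curve $Z_k$ is the normalization of the projective closure of the affine curve given by the displayed equation; it is a smooth projective curve over $F=\mathbb{Q}(k)\subset\mathbb{C}$, and $x,y$ are regarded as rational functions on it. For a field $L$, $K_2(L)=L^*\otimes_{\mathbb{Z}}L^*/\langle a\otimes(1-a): a\in L,\ a\ne0,1\rangle$; the class of $a\otimes b$ is written $\{a,b\}$. For a smooth projective geometrically irreducible curve $C$ over a field $F$, the tame $K_2$ group $K_2^T(C)$ is the subgroup of $K_2(F(C))$ of elements $\alpha$ whose tame symbol $T_P(\alpha)$ is trivial at every closed point $P$ of $C$, where $T_P(\{a,b\})=(-1)^{\mathrm{ord}_P(a)\mathrm{ord}_P(b)}\frac{a^{\mathrm{ord}_P(b)}}{b^{\mathrm{ord}_P(a)}}(P)$.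 Saying that a symbol $\{a,b\}$ lies in $K_2^T(C)\otimes\mathbb{Q}$ means that its image in $K_2(F(C))\otimes\mathbb{Q}$ lies in the subspace $K_2^T(C)\otimes\mathbb{Q}$. *)

(* Defs.v *)
From HB Require Import structures.
From mathcomp Require Import all_boot all_order all_algebra.
From mathcomp Require Import generic_quotient ring_quotient.
From mathcomp Require Import ring lra zify.
From mathcomp Require Import boolp classical_sets reals Rstruct.
From mathcomp.multinomials Require Import freeg.
From mathcomp.real_closed Require Import complex.

Set Implicit Arguments.
Unset Strict Implicit.
Unset Printing Implicit Defensive.

Import Order.TTheory GRing.Theory Num.Theory.
Local Open Scope ring_scope.
Local Open Scope quotient_scope.

Notation C := (complex Rdefinitions.R).

Inductive subgroup_gen (V : zmodType) (S : V -> Prop) : V -> Prop :=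
| subgroup_gen_in u of S u : subgroup_gen S u
| subgroup_gen0 : subgroup_gen S 0
| subgroup_genB u v of subgroup_gen S u & subgroup_gen S v :
    subgroup_gen S (u - v).

Definition subgroup_pred (V : zmodType) (S : V -> Prop) : {pred V} :=
  fun u => `[< subgroup_gen S u >].

Lemma subgroup_pred_closed (V : zmodType) (S : V -> Prop) :
  zmod_closed (subgroup_pred S).
Proof.
split=> [|u v /asboolP Su /asboolP Sv]; apply/asboolP.
  exact: subgroup_gen0.
exact: subgroup_genB.
Qed.

HB.instance Definition _ (V : zmodType) (S : V -> Prop) :=
  GRing.isZmodClosed.Build V (subgroup_pred S) (subgroup_pred_closed S).

Definition zquot (V : zmodType) (S : V -> Prop) : Type :=
  Quotient.quot (subgroup_pred S).

HB.instance Definition _ (V : zmodType) (S : V -> Prop) :=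
  GRing.Zmodule.on (zquot S).
HB.instance Definition _ (V : zmodType) (S : V -> Prop) :=
  Quotient.on (zquot S).

(* M (x)_Z Q, by generators m (x) q and biadditivity.                         *)
Inductive tensQ_relator (M : zmodType) : {freeg (M * rat)%type} -> Prop :=
| tensQ_addl (m n : M) (q : rat) :
    tensQ_relator (<< (m + n, q) >> - << (m, q) >> - << (n, q) >>)
| tensQ_addr (m : M) (q r : rat) :
    tensQ_relator (<< (m, q + r) >> - << (m, q) >> - << (m, r) >>).

Definition tensQ (M : zmodType) : zmodType := zquot (@tensQ_relator M).

Definition tens (M : zmodType) (m : M) (q : rat) : tensQ M :=
  \pi_(tensQ M) << (m, q) >>.

(* For a subgroup N of M, [inQspan N m] says that the image m (x) 1 of m lies *)
(* in the subspace N (x) Q of M (x) Q, i.e. in the image of N (x) Q, which is *)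
(* the subgroup generated by the n (x) q with n in N.                         *)
Definition inQspan (M : zmodType) (N : M -> Prop) (m : M) : Prop :=
  subgroup_gen (fun t => exists n q, N n /\ t = tens n q) (tens m 1).

(* Linear independence over Q of the images m_i (x) 1 in M (x) Q; the scalar  *)
(* multiple q . (m (x) 1) is m (x) q.                                         *)
Definition Qindependent (M : zmodType) (n : nat) (m : 'I_n -> M) : Prop :=
  forall q : 'I_n -> rat, \sum_i tens (m i) (q i) = 0 -> forall i, q i = 0.

(* K_2 of a field: the tensor square of L^* (free abelian group on pairs      *)
(* modulo bimultiplicativity) modulo the Steinberg relations.                 *)
Definition mulgrp (L : fieldType) := {a : L | a != 0}.

Inductive K2_relator (L : fieldType) :
  {freeg (mulgrp L * mulgrp L)%type} -> Prop :=
| K2_mull (a b c ab : mulgrp L) of val ab = val a * val b :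
    K2_relator (<< (ab, c) >> - << (a, c) >> - << (b, c) >>)
| K2_mulr (a b c bc : mulgrp L) of val bc = val b * val c :
    K2_relator (<< (a, bc) >> - << (a, b) >> - << (a, c) >>)
| K2_steinberg (a b : mulgrp L) of val b = 1 - val a :
    K2_relator << (a, b) >>.

Definition K2 (L : fieldType) : zmodType := zquot (@K2_relator L).

Definition to_mulgrp (L : fieldType) (a : L) : mulgrp L :=
  insubd (exist _ 1 (oner_neq0 L) : mulgrp L) a.

(* The symbol {a, b}; meaningful only for nonzero a and b (the argument 0 is  *)
(* replaced by 1).                                                            *)
Definition symb (L : fieldType) (a b : L) : K2 L :=
  \pi_(K2 L) << (to_mulgrp a, to_mulgrp b) >>.

(* Closed points of the smooth projective curve with function field L over F: *)
(* the normalized discrete valuations of L that are trivial on F. The value   *)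
(* at 0 is fixed to the junk value 0, so that a point determines its ord.     *)
Record place (F L : fieldType) (iota : {rmorphism F -> L}) := Place {
  ord :> L -> int;
  ord_zero : ord 0 = 0;
  ordM : forall a b, a != 0 -> b != 0 -> ord (a * b) = ord a + ord b;
  ordD : forall a b, a != 0 -> b != 0 -> a + b != 0 ->
    Num.min (ord a) (ord b) <= ord (a + b);
  ord_const : forall c, ord (iota c) = 0;
  ord_unif : exists t, ord t = 1 }.

HB.instance Definition _ (F L : fieldType) (iota : {rmorphism F -> L}) :=
  gen_eqMixin (place iota).
HB.instance Definition _ (F L : fieldType) (iota : {rmorphism F -> L}) :=
  gen_choiceMixin (place iota).

Section Curve.
Variables (F L : fieldType) (iota : {rmorphism F -> L}).
Implicit Types P : place iota.

Definition regular_at P (a : L) : Prop := 0 <= ord P a.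
Definition vanishes_at P (a : L) : Prop := a = 0 \/ 0 < ord P a.

(* The function, regular and nonvanishing at P, whose value at P is           *)
(* T_P({a, b}).                                                               *)
Definition tame_fun P (a b : L) : L :=
  (-1) ^ (ord P a * ord P b) * (a ^ ord P b / b ^ ord P a).

Definition tame_freeg P (s : {freeg (mulgrp L * mulgrp L)%type}) : L :=
  \prod_(ab <- dom s) tame_fun P (val ab.1) (val ab.2) ^ coeff ab s.

(* T_P(alpha) = 1 in the residue field at P. By [tame_trivialP] this does not *)
(* depend on the representative of alpha.                                     *)
Definition tame_trivial P (alpha : K2 L) : Prop :=
  vanishes_at P (tame_freeg P (repr alpha) - 1).

Definition K2T (alpha : K2 L) : Prop := forall P, tame_trivial P alpha.

(* Dimension over F of A / B, for F-subspaces B of A of L (0 if infinite).    *)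
Definition has_quot_dim (A B : L -> Prop) (n : nat) : Prop :=
  exists e : 'I_n -> L,
  [/\ forall i, A (e i),
      forall c : 'I_n -> F, B (\sum_i iota (c i) * e i) -> forall i, c i = 0
    & forall a, A a -> exists c : 'I_n -> F, B (a - \sum_i iota (c i) * e i)].

Definition quot_dim (A B : L -> Prop) : nat :=
  xget 0%N [set n | has_quot_dim A B n]%classic.

(* The degree of a closed point is the degree of its residue field over F.    *)
Definition degree_pt P : nat := quot_dim (regular_at P) (vanishes_at P).

Definition divisor := {freeg (place iota)}.

Definition degree (D : divisor) : int :=
  \sum_(P <- dom D) coeff P D * (degree_pt P)%:Z.

Definition RR_space (D : divisor) (f : L) : Prop :=
  f = 0 \/ forall P, - coeff P D <= ord P f.

Definition ell (D : divisor) : nat := quot_dim (RR_space D) (fun f => f = 0).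

(* The genus, as the maximum over all divisors D of deg D - l(D) + 1.         *)
Definition has_genus (g : nat) : Prop :=
  (forall D : divisor, degree D - (ell D)%:Z + 1 <= g%:Z) /\
  (exists D : divisor, degree D - (ell D)%:Z + 1 = g%:Z).

End Curve.

(* T_P is well defined on K_2: the triviality of the tame symbol at P can be  *)
(* read off any representative.                                               *)
Section TameWellDefined.
Variables (F L : fieldType) (iota : {rmorphism F -> L}) (P : place iota).
Implicit Types (a b t : L) (u v : mulgrp L).
Implicit Types s r : {freeg (mulgrp L * mulgrp L)%type}.

Let ord1 : ord P 1 = 0.
Proof. by rewrite -(rmorph1 iota) ord_const. Qed.

Let ordN1 : ord P (-1) = 0.
Proof. by rewrite -(rmorphN1 iota) ord_const. Qed.

Let ordN a : ord P (- a) = ord P a.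
Proof.
have [->|a0] := eqVneq a 0; first by rewrite oppr0.
by rewrite -mulN1r ordM ?oppr_eq0 ?oner_eq0 // ordN1 add0r.
Qed.

Let ordV a : ord P a^-1 = - ord P a.
Proof.
have [->|a0] := eqVneq a 0; first by rewrite invr0 ord_zero oppr0.
by apply/eqP; rewrite -addr_eq0 -ordM ?invr_eq0 // mulVf // ord1.
Qed.

Let ordX a (n : int) : a != 0 -> ord P (a ^ n) = n * ord P a.
Proof.
move=> a0; have X (m : nat) : ord P (a ^+ m) = m%:Z * ord P a.
  elim: m => [|m IH]; first by rewrite expr0 ord1 mul0r.
  by rewrite exprS ordM ?expf_neq0 // IH intS mulrDl mul1r.
case: n => m; first exact: X.
by rewrite NegzE -invr_expz ordV X mulNr.
Qed.

Let res1 t := vanishes_at P (t - 1).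

Let res1_neq0 t : res1 t -> t != 0.
Proof.
move=> [/eqP|]; first by rewrite subr_eq0 => /eqP ->; exact: oner_neq0.
by apply: contraTneq => ->; rewrite sub0r ordN1 ltxx.
Qed.

Let vanishesD a b : vanishes_at P a -> vanishes_at P b -> vanishes_at P (a + b).
Proof.
move=> [->|a0] [->|b0]; rewrite ?addr0 ?add0r; [by left | by right | by right |].
have na : a != 0 by apply: contraTneq a0 => ->; rewrite ord_zero ltxx.
have nb : b != 0 by apply: contraTneq b0 => ->; rewrite ord_zero ltxx.
have [->|nab] := eqVneq (a + b) 0; [by left | right].
by apply: lt_le_trans (ordD P na nb nab); rewrite lt_min a0.
Qed.

Let vanishesM a b : 0 <= ord P a -> vanishes_at P b -> vanishes_at P (a * b).
Proof.
move=> a0 [->|b0]; first by rewrite mulr0; left.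
have nb : b != 0 by apply: contraTneq b0 => ->; rewrite ord_zero ltxx.
have [->|na] := eqVneq a 0; first by rewrite mul0r; left.
by right; rewrite ordM // ltr_wpDl.
Qed.

Let res1_ord t : res1 t -> ord P t = 0.
Proof.
move=> h; have nt := res1_neq0 h; case: h => [/eqP|h].
  by rewrite subr_eq0 => /eqP ->.
have nt1 : t - 1 != 0 by apply: contraTneq h => ->; rewrite ord_zero ltxx.
have t1 : t - (t - 1) = 1 by ring.
have H1 : Num.min (ord P (t - 1)) (ord P 1) <= ord P t.
  by have := @ordD _ _ _ P (t - 1) 1; rewrite subrK oner_eq0; apply.
have H2 : Num.min (ord P t) (ord P (- (t - 1))) <= ord P 1.
  have := @ordD _ _ _ P t (- (t - 1)); rewrite t1 oppr_eq0 oner_eq0; exact.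
move: H1 H2; rewrite ord1 ordN /Num.min; case: ltP; case: ltP; lia.
Qed.

Let res1M a b : res1 a -> res1 b -> res1 (a * b).
Proof.
move=> ha hb; rewrite /res1.
have -> : a * b - 1 = a * (b - 1) + (a - 1) by ring.
by apply: vanishesD => //; apply: vanishesM => //; rewrite res1_ord.
Qed.

Let res1V t : res1 t -> res1 t^-1.
Proof.
move=> ht; have nt := res1_neq0 ht; rewrite /res1.
have -> : t^-1 - 1 = - t^-1 * (t - 1) by field.
by apply: vanishesM => //; rewrite ordN ordV res1_ord.
Qed.

Let res1_1 : res1 1. Proof. by left; rewrite subrr. Qed.

Let tame_neq0 a b : a != 0 -> b != 0 -> tame_fun P a b != 0.
Proof.
by move=> na nb; rewrite !mulf_neq0 ?invr_eq0 ?expfz_neq0 ?oppr_eq0 ?oner_eq0.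
Qed.

Let tame_freegE (r : seq (mulgrp L * mulgrp L)) s : uniq r -> {subset dom s <= r} ->
  tame_freeg P s = \prod_(ab <- r) tame_fun P (val ab.1) (val ab.2) ^ coeff ab s.
Proof.
move=> ur sr; rewrite [RHS](bigID (mem (dom s))) /= [X in _ * X]big1 ?mulr1.
  rewrite -big_filter; apply: perm_big; apply: uniq_perm.
  - exact: uniq_dom.
  - exact: filter_uniq.
  - by move=> z; rewrite mem_filter; case: (boolP (z \in dom s)) => // /sr ->.
by move=> z; rewrite mem_dom negbK => /eqP ->; rewrite expr0z.
Qed.

Let tame_freegB s r : tame_freeg P (s - r) = tame_freeg P s / tame_freeg P r.
Proof.
pose w := undup (dom s ++ dom r ++ dom (s - r)).
have ur : uniq w by exact: undup_uniq.
rewrite !(@tame_freegE w) //; first last.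
- by move=> z; rewrite mem_undup !mem_cat => ->; rewrite ?orbT.
- by move=> z; rewrite mem_undup !mem_cat => ->; rewrite ?orbT.
- by move=> z; rewrite mem_undup !mem_cat => ->; rewrite ?orbT.
rewrite -prodfV -big_split /=; apply: eq_bigr => -[a b] _ /=.
rewrite coeffB expfzDr -?invr_expz //.
by apply: tame_neq0; [exact: (valP a) | exact: (valP b)].
Qed.

Let tame_freegU u v : tame_freeg P << (u, v) >> = tame_fun P (val u) (val v).
Proof.
rewrite (@tame_freegE [:: (u, v)]) //.
  by rewrite big_seq1 coeffU eqxx /= mulr1.
by move=> z; rewrite domU1.
Qed.

Let signzD (m n : int) : ((-1) ^ (m + n) : L) = (-1) ^ m * (-1) ^ n.
Proof. by rewrite expfzDr // oppr_eq0 oner_eq0. Qed.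

Let signz_sqr (m : int) : ((-1) ^ (m * m) : L) = (-1) ^ m.
Proof.
have X (n : nat) : (-1) ^+ (n * n)%N = (-1) ^+ n :> L.
  by rewrite -signr_odd oddM andbb signr_odd.
case: m => n; first by rewrite -PoszM -!exprnP X.
by rewrite NegzE mulrNN -PoszM -invr_expz -!exprnP X invr_sign.
Qed.

Let tame_mull a b c : a != 0 -> b != 0 -> c != 0 ->
  tame_fun P (a * b) c = tame_fun P a c * tame_fun P b c.
Proof.
move=> na nb nc; rewrite /tame_fun ordM // mulrDl signzD expfzMl expfzDr //.
by rewrite invfM; ring.
Qed.

Let tame_mulr a b c : a != 0 -> b != 0 -> c != 0 ->
  tame_fun P a (b * c) = tame_fun P a b * tame_fun P a c.
Proof.
move=> na nb nc; rewrite /tame_fun ordM // mulrDr signzD expfzMl expfzDr //.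
by rewrite invfM; ring.
Qed.

Let res1X t (n : int) : res1 t -> res1 (t ^ n).
Proof.
move=> ht; have X (m : nat) : res1 (t ^+ m).
  by elim: m => [|m IH]; rewrite ?expr0 // exprS; exact: res1M.
by case: n => m; [exact: X | rewrite NegzE -invr_expz; apply: res1V; exact: X].
Qed.

Let tame_steinberg a : a != 0 -> 1 - a != 0 -> res1 (tame_fun P a (1 - a)).
Proof.
move=> na nb.
have small b : 0 < ord P b -> res1 (1 - b).
  by move=> hb; rewrite /res1; right; rewrite (_ : _ - 1 = - b) ?ordN //; ring.
case: (ltrgtP (ord P a) 0) => ha.
- have hV : res1 (1 - a^-1) by apply: small; rewrite ordV oppr_gt0.
  have e : 1 - a = - a * (1 - a^-1) by field.
  have nV := res1_neq0 hV.
  have ob : ord P (1 - a) = ord P a.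
    by rewrite e ordM ?oppr_eq0 // ordN (res1_ord hV) addr0.
  have -> : tame_fun P a (1 - a) = (1 - a^-1)^-1 ^ ord P a; last first.
    by apply: res1X; apply: res1V.
  rewrite /tame_fun ob e -[- a]mulN1r -mulrA !expfzMl.
  have -> : ((-1) ^ (ord P a * ord P a) : L) = (-1) ^ ord P a.
    exact: signz_sqr.
  rewrite exprz_inv -invr_expz; field.
  by rewrite !expfz_neq0 ?oppr_eq0 ?oner_eq0.
- have hb := small _ ha; have ob := res1_ord hb.
  rewrite /tame_fun ob mulr0 !expr0z mul1r mul1r.
  by apply: res1V; apply: res1X.
- rewrite /tame_fun ha mul0r !expr0z mul1r divr1.
  have [->|hb] := eqVneq (ord P (1 - a)) 0; first by rewrite expr0z.
  have hb0 : 0 < ord P (1 - a).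
    have := @ordD _ _ _ P 1 (- a); rewrite oppr_eq0 oner_eq0 na nb ordN ord1 ha.
    by move=> /(_ isT isT isT); rewrite minxx lt_def hb.
  by apply: res1X; have := small _ hb0; rewrite (_ : 1 - _ = a) //; ring.
Qed.

Lemma tame_freeg_relator s : subgroup_gen (@K2_relator L) s ->
  vanishes_at P (tame_freeg P s - 1).
Proof.
elim=> [{}s|| u v _ hu _ hv].
- case=> [a b c ab e|a b c bc e|a b e].
  + rewrite !tame_freegB !tame_freegU e tame_mull ?(valP a) ?(valP b) ?(valP c) //.
    rewrite (_ : _ / _ / _ = 1) //; field.
    by rewrite !tame_neq0 ?(valP a) ?(valP b) ?(valP c).
  + rewrite !tame_freegB !tame_freegU e tame_mulr ?(valP a) ?(valP b) ?(valP c) //.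
    rewrite (_ : _ / _ / _ = 1) //; field.
    by rewrite !tame_neq0 ?(valP a) ?(valP b) ?(valP c).
  + rewrite tame_freegU e; apply: tame_steinberg; rewrite ?(valP a) // -e.
    exact: (valP b).
- by rewrite (@tame_freegE [::]) ?big_nil // => z; rewrite dom0.
- by rewrite tame_freegB; apply: res1M => //; apply: res1V.
Qed.

Lemma tame_trivialP s :
  tame_trivial P (\pi_(K2 L) s) <-> vanishes_at P (tame_freeg P s - 1).
Proof.
have E : tame_freeg P s
  = tame_freeg P (repr (\pi_(K2 L) s)) / tame_freeg P (repr (\pi_(K2 L) s) - s).
  by rewrite -tame_freegB subKr.
have h : res1 (tame_freeg P (repr (\pi_(K2 L) s) - s)).
  apply: tame_freeg_relator; apply/asboolP.
  suff : repr (\pi_(K2 L) s) - s \in subgroup_pred (@K2_relator L) by [].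
  by rewrite Quotient.idealrBE; apply/eqP; rewrite reprK.
rewrite /tame_trivial E; split=> H.
  by apply: res1M => //; apply: res1V.
have nh := res1_neq0 h.
by have := res1M H h; rewrite /res1 divfK.
Qed.

End TameWellDefined.

(* Polynomials in two variables: p : {poly {poly F}} has outer variable y and *)
(* inner variable x.                                                          *)
Definition eval2 (F L : fieldType) (iota : {rmorphism F -> L}) (x y : L)
    (p : {poly {poly F}}) : L :=
  (map_poly (horner_eval x \o map_poly iota) p).[y].

Definition irreducible2 (E : fieldType) (p : {poly {poly E}}) : Prop :=
  [/\ p != 0, p \isn't a GRing.unit &
      forall q r : {poly {poly E}}, p = q * r ->
        q \is a GRing.unit \/ r \is a GRing.unit].

Definition absolutely_irreducible (F : fieldType) (p : {poly {poly F}}) : Prop :=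
  forall (E : fieldType) (f : {rmorphism F -> E}),
    irreducible2 (map_poly (map_poly f) p).

(* L is the field of fractions of F[X, Y] / (p), x and y being the classes of *)
(* X and Y.                                                                   *)
Definition function_field (F L : fieldType) (iota : {rmorphism F -> L})
    (p : {poly {poly F}}) (x y : L) : Prop :=
  (forall q : {poly {poly F}},
     eval2 iota x y q = 0 <-> exists r : {poly {poly F}}, q = p * r) /\
  (forall z : L, exists a b : {poly {poly F}},
     eval2 iota x y b != 0 /\ z = eval2 iota x y a / eval2 iota x y b).

(* Q(k), as the intersection of the subfields of C that contain k.            *)
Definition Qadj (k : C) : {pred C} :=
  fun z => `[< forall S : {pred C}, divring_closed S -> k \in S -> z \in S >].

Lemma Qadj_closed (k : C) : divring_closed (Qadj k).
Proof.
split=> [|a b /asboolP Qa /asboolP Qb|a b /asboolP Qa /asboolP Qb];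
  apply/asboolP=> S Sc Sk; have [S1 SB SD] := Sc => //.
- by apply: SB; [apply: Qa | apply: Qb].
- by apply: SD; [apply: Qa | apply: Qb].
Qed.

Lemma Qadj_gen (k : C) : k \in Qadj k.
Proof. by apply/asboolP. Qed.

HB.instance Definition _ (k : C) :=
  GRing.isDivringClosed.Build C (Qadj k) (Qadj_closed k).

Record Qof (k : C) := QofMk { Qof_val : C; _ : Qof_val \in Qadj k }.

HB.instance Definition _ (k : C) := [isSub for @Qof_val k].
HB.instance Definition _ (k : C) := [Choice of Qof k by <:].
HB.instance Definition _ (k : C) := [SubChoice_isSubIntegralDomain of Qof k by <:].
HB.instance Definition _ (k : C) := [SubIntegralDomain_isSubField of Qof k by <:].

Definition Qgen (k : C) : Qof k := QofMk (Qadj_gen k).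

(* The boolean is the choice of sign: (-1) ^+ s is 1 for s = false and -1 for *)
(* s = true.                                                                  *)
Inductive Zfamily := FamI of bool | FamII | FamIII of bool.

Section Families.
Variables (F : fieldType) (k : F).

Definition family_f (fam : Zfamily) : {poly F} :=
  match fam with
  | FamI s => 'X^5 + 1 + k *: ('X^4 + 'X) + (- k - 1 + (-1) ^+ s) *: ('X^3 + 'X^2)
  | FamII => 'X^6 + 1 + k *: ('X^5 + 'X) - ('X^4 + 'X^2)
             + (- (k *+ 2) + 2) *: 'X^3
  | FamIII s => 'X^6 + 1 + k *: ('X^5 + 'X) - (1 + (-1) ^+ s) *: ('X^4 + 'X^2)
                - (k *+ 2) *: 'X^3
  end.

Definition family_g (fam : Zfamily) : {poly F} :=
  match fam with FamI _ => 'X^5 | _ => 'X^6 end.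

Definition family_poly (fam : Zfamily) : {poly {poly F}} :=
  'X^2 + (family_f fam)%:P * 'X + (family_g fam)%:P.

End Families.

(* A model (L, x, y) of the function field over Q(k) of the curve Z_k, for a  *)
(* parameter k satisfying the standing assumptions.                           *)
Record curve_Z (fam : Zfamily) (k : C) (L : fieldType)
    (iota : {rmorphism Qof k -> L}) (x y : L) : Prop := CurveZ {
  curve_Z_absirr : absolutely_irreducible (family_poly (Qgen k) fam);
  curve_Z_ff : function_field iota (family_poly (Qgen k) fam) x y;
  curve_Z_genus : has_genus iota 3%N }.

(* The arguments of the symbols {x, y}, {x - 1, y}, {x + 1, y} are nonzero,   *)
(* so that [symb] does not take a junk value on them.                         *)
Lemma curve_Z_neq0 (fam : Zfamily) (k : C) (L : fieldType)
    (iota : {rmorphism Qof k -> L}) (x y : L) :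
  curve_Z fam iota x y -> [/\ x != 0, x - 1 != 0, x + 1 != 0 & y != 0].
Proof.
case=> _ [ker _] _.
set p := family_poly (Qgen k) fam in ker.
have [mp sp] : p \is monic /\ size p = 3%N.
  have e : p = 'X^2 + ((family_f (Qgen k) fam)%:P * 'X
                       + (family_g (Qof k) fam)%:P).
    by rewrite addrA.
  have s2 : (size ((family_f (Qgen k) fam)%:P * 'X
                   + (family_g (Qof k) fam)%:P)%R < 3)%N.
    by rewrite size_MXaddC; case: ifP => // _; rewrite ltnS ltnS size_polyC_leq1.
  split; last by rewrite e size_polyDl size_polyXn.
  by rewrite monicE e lead_coefDl ?size_polyXn ?lead_coefXn.
have low (q : {poly {poly Qof k}}) : q != 0 -> (size q < 3)%N -> eval2 iota x y q != 0.
  move=> nq sq; apply/eqP => /ker[r e].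
  have nr : r != 0 by apply: contraNneq nq => r0; rewrite e r0 mulr0.
  move: sq; rewrite e size_monicM // sp -(prednK (_ : 0 < size r)%N) ?addnS //.
  by rewrite lt0n size_poly_eq0.
have ev c : x - iota c != 0.
  have := low ('X - c%:P)%:P; rewrite polyC_eq0 polyXsubC_eq0 size_polyC.
  rewrite polyXsubC_eq0 /eval2 map_polyC hornerC => /(_ isT isT).
  by rewrite /= /horner_eval rmorphB /= map_polyX map_polyC hornerXsubC.
split.
- by have := ev 0; rewrite rmorph0 subr0.
- by have := ev 1; rewrite rmorph1.
- by have := ev (-1); rewrite rmorphN1 opprK.
- have := low 'X; rewrite polyX_eq0 size_polyX /eval2 => /(_ isT isT).
  by rewrite map_polyX hornerX.
Qed.

(* Main.v *)
Require Import Defs.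
From HB Require Import structures.
From mathcomp Require Import all_boot all_order all_algebra.
From mathcomp Require Import generic_quotient ring_quotient boolp.
From mathcomp Require Import reals Rstruct.
From mathcomp.multinomials Require Import freeg.
From mathcomp.real_closed Require Import complex.
From mathcomp Require Import ring.

(** Tameness is a local computation. Twice {x - a, y} is {x - a, y^2}, whose tame
symbol at P is the square of u^(ord y) / y^(ord u), u = x - a; so it is enough that
this function takes the value 1 or -1 at P. The coefficients are chosen for this:
for a = 1 and a = -1 the roots of y^2 + f(a) y + g(a) are 1 or -1, for a = 0 the
polynomial is y^2 + y, and the equation is invariant under (x, y) -> (1/x, y/x^n), which moves
the points at infinity to points over x = 0. See [tame_over_zero],
[tame_over_finite], [tame_sign].

Independence is detected by the real regulator, the integral along a loop of
    ln|u| d arg v - ln|v| d arg u.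
It is bilinear in (u, v), and it kills Steinberg symbols because
    ln|z| d arg(1 - z) - ln|1 - z| d arg z
is the differential of a single-valued function on the plane minus 0 and 1, the
Bloch-Wigner dilogarithm ([BW_derive], [reg_steinberg]). Write f = k q + h with q a
product of factors x, x - 1, x + 1, each of them present, and h independent of k.
For a in {0, 1, -1} the loop lies over the circle |x - a| = r, 1/4 < r < 1/2. When
|k| is large, one root of the equation is y = - k q(x) G(x) there, G being close to
1 ([csqrt_branch], [branch_exists]), so the integral for {x - b, y} is
- 2 pi ln|k| if b = a and 0 if b <> a, up to a bound that depends neither on k nor
on r ([reg_asymptotics]). The 3 x 3 matrix of these integrals is therefore
invertible as soon as ln|k| is large ([near_scalar_injective]).

The functions of a K_2 relation may vanish on the loop. A relation involves finitely
many functions, and each of them vanishes on the loop for finitely many r only, by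
[norm_exists]. The functional on K_2 tensor Q is therefore a family indexed by r,
and all its properties hold outside a finite set of radii ([mostly],
[reg_relation]). *)

Set Implicit Arguments.
Unset Strict Implicit.
Unset Printing Implicit Defensive.

Import Order.TTheory GRing.Theory Num.Theory.
Local Open Scope ring_scope.
Local Open Scope quotient_scope.

(** * The equation of the curve *)

(** The roots of G^2 - (1 + e) G + eps are (1 + e + s) / 2 with s^2 the discriminant,
which is expanded here around 1; [c] is 1 / 2. *)
Lemma quadratic_formula (F : fieldType) (c e s eps : F) : c * 2 = 1 ->
  s * s = 1 + (e + e + e * e - (eps + eps + eps + eps)) ->
  let G := c * (1 + e + s) in G * G - (1 + e) * G + eps = 0.
Proof.
move=> c2 ss G.
have -> : G * G - (1 + e) * G + eps
  = c * c * (s * s - (1 + (e + e + e * e - (eps + eps + eps + eps))))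
    + (c * 2 - 1) * (c * (1 + e) * (1 + e) + c * (1 + e) * s - eps * (c * 2 + 1)) by rewrite /G; ring.
by rewrite ss c2 !subrr mulr0 mul0r addr0.
Qed.

(** The roots, with multiplicity, of the coefficient q of [k] in [family_f]. *)
Definition fam_pts (F : nzRingType) (fam : Zfamily) : seq F :=
  match fam with FamI _ => [:: 0; 1; 1; -1] | _ => [:: 0; 1; 1; -1; -1] end.

(** The part of [family_f] that does not involve [k]. *)
Definition fam_h (F : nzRingType) (fam : Zfamily) (z : F) : F :=
  match fam with
  | FamI s => z ^+ 5 + 1 + (-1 + (-1) ^+ s) * (z ^+ 3 + z ^+ 2)
  | FamII => z ^+ 6 + 1 - (z ^+ 4 + z ^+ 2) + (z ^+ 3 + z ^+ 3)
  | FamIII s => z ^+ 6 + 1 - (1 + (-1) ^+ s) * (z ^+ 4 + z ^+ 2)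
  end.

Lemma family_fE (F : fieldType) (k z : F) fam :
  (family_f k fam).[z] = k * \prod_(b <- fam_pts F fam) (z - b) + fam_h fam z.
Proof.
by case: fam => [s||s]; rewrite /family_f /fam_pts !big_cons big_nil !hornerE /=; ring.
Qed.

(** Substituting y = - k q G and dividing by (k q)^2 gives an equation for G whose
coefficients differ from those of G^2 - G by O(1 / k). *)
Lemma branch_equation (F : fieldType) (k q h g G : F) : k != 0 -> q != 0 ->
  G * G - (1 + h / (k * q)) * G + g / (k * q * (k * q)) = 0 ->
  (- k * (q * G)) ^+ 2 + (k * q + h) * (- k * (q * G)) + g = 0.
Proof.
move=> nk nq e.
have -> : (- k * (q * G)) ^+ 2 + (k * q + h) * (- k * (q * G)) + g
  = (k * q) ^+ 2 * (G * G - (1 + h / (k * q)) * G + g / (k * q * (k * q))) by field; rewrite nk nq.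
by rewrite e mulr0.
Qed.

(** A matrix close to - A times the identity has no kernel: sum the n inequalities
A |c i| <= M (|c 0| + ... + |c (n - 1)|). *)
Lemma near_scalar_injective (R : realFieldType) n (A M : R) (c : 'I_n -> R)
    (E : 'I_n -> 'I_n -> R) : 0 <= A -> n%:R * M < A ->
  (forall i j, `|E i j + A * (i == j)%:R| <= M) ->
  (forall i, \sum_j c j * E i j = 0) -> forall i, c i = 0.
Proof.
move=> A0 MA bE h; pose S := \sum_j `|c j|.
have bound i : A * `|c i| <= M * S.
  have e : A * c i = \sum_j c j * (E i j + A * (i == j)%:R).
    under eq_bigr do rewrite mulrDr.
    rewrite big_split /= h add0r (bigD1 i) //= eqxx mulr1 mulrC big1 ?addr0 // => j.
    by rewrite eq_sym => /negPf ->; rewrite mulr0 mulr0.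
  rewrite -{1}(ger0_norm A0) -normrM e mulr_sumr.
  apply: le_trans (ler_norm_sum _ _ _) _; apply: ler_sum => j _.
  by rewrite normrM mulrC; apply: ler_wpM2r.
have S0 : S = 0.
  apply/eqP; rewrite eq_le sumr_ge0 // andbT leNgt; apply/negP => Sp.
  have : A * S <= n%:R * M * S.
    rewrite mulr_sumr; apply: le_trans (ler_sum _ (fun i _ => bound i)) _.
    by rewrite sumr_const card_ord -mulrA mulr_natl.
  by rewrite ler_pM2r // leNgt MA.
move=> i; apply/normr0_eq0/eqP; rewrite eq_le normr_ge0 andbT -S0.
by rewrite /S (bigD1 i) //= lerDl sumr_ge0.
Qed.

Lemma map_family_f (E F : fieldType) (phi : {rmorphism E -> F}) (k : E) fam :
  map_poly phi (family_f k fam) = family_f (phi k) fam.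
Proof.
pose simp := (rmorphD, rmorphN1, rmorphN, rmorph1, rmorphMn, rmorph_sign,
  map_polyXn, map_polyX, map_polyZ).
by case: fam => [s||s] /=; rewrite !simp /= !simp /= ?simp.
Qed.

Lemma map_family_g (E F : fieldType) (phi : {rmorphism E -> F}) fam :
  map_poly phi (family_g E fam) = family_g F fam.
Proof. by case: fam => [s||s] /=; rewrite map_polyXn. Qed.

(** * Evaluation, norms and quotients *)

Lemma zquot_piD (V : zmodType) (S : V -> Prop) (u v : V) :
  \pi_(zquot S) (u + v) = \pi_(zquot S) u + \pi_(zquot S) v.
Proof. by rewrite -(raddfD (\pi_(zquot S))). Qed.

Lemma zquot_pi0 (V : zmodType) (S : V -> Prop) : \pi_(zquot S) 0 = 0.
Proof. by rewrite raddf0. Qed.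

Lemma zquot_relation (V : zmodType) (S : V -> Prop) (u v : V) :
  \pi_(zquot S) u = \pi_(zquot S) v <-> subgroup_gen S (u - v).
Proof.
split=> [e|h].
  have : u - v \in subgroup_pred S by rewrite Quotient.idealrBE e.
  by move=> /asboolP.
by apply/eqP; rewrite -Quotient.idealrBE; apply/asboolP.
Qed.

Section Eval2.
Variables (F L : fieldType) (iota : {rmorphism F -> L}) (x y : L).

Let ev2 : {rmorphism {poly {poly F}} -> L} :=
  (horner_eval y \o map_poly (horner_eval x \o map_poly iota)).

Lemma eval2D p q : eval2 iota x y (p + q) = eval2 iota x y p + eval2 iota x y q.
Proof. exact: (rmorphD ev2). Qed.

Lemma eval2B p q : eval2 iota x y (p - q) = eval2 iota x y p - eval2 iota x y q.
Proof. exact: (rmorphB ev2). Qed.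

Lemma eval2M p q : eval2 iota x y (p * q) = eval2 iota x y p * eval2 iota x y q.
Proof. exact: (rmorphM ev2). Qed.

Lemma eval20 : eval2 iota x y 0 = 0.
Proof. exact: (rmorph0 ev2). Qed.

Lemma eval21 : eval2 iota x y 1 = 1.
Proof. exact: (rmorph1 ev2). Qed.

Lemma eval2_polyC (c : {poly F}) : eval2 iota x y c%:P = (map_poly iota c).[x].
Proof. by rewrite /eval2 map_polyC hornerC. Qed.

Lemma eval2_X : eval2 iota x y 'X = y.
Proof. by rewrite /eval2 map_polyX hornerX. Qed.

Lemma eval2_quadratic (f g : {poly F}) :
  eval2 iota x y ('X^2 + f%:P * 'X + g%:P)
  = y ^+ 2 + (map_poly iota f).[x] * y + (map_poly iota g).[x].
Proof. by rewrite !eval2D expr2 !eval2M eval2_X !eval2_polyC. Qed.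

End Eval2.

Section Norm.
Variables (F L : fieldType) (iota : {rmorphism F -> L}) (x y : L) (f g : {poly F}).
Let p : {poly {poly F}} := 'X^2 + f%:P * 'X + g%:P.
Hypothesis ker : forall q, eval2 iota x y q = 0 <-> exists r, q = p * r.

Let size_linear (b0 b1 : {poly F}) : (size (b1%:P * 'X + b0%:P)%R < 3)%N.
Proof. by rewrite size_MXaddC; case: ifP => // _; rewrite ltnS ltnS size_polyC_leq1. Qed.

Let pE : p = 'X^2 + (f%:P * 'X + g%:P). Proof. by rewrite addrA. Qed.

Let size_p : size p = 3.
Proof. by rewrite pE size_polyDl size_polyXn. Qed.

Let monic_p : p \is monic.
Proof. by rewrite monicE pE lead_coefDl ?size_polyXn ?lead_coefXn. Qed.

Let linear_eq0 (b0 b1 : {poly F}) :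
  eval2 iota x y (b1%:P * 'X + b0%:P) = 0 -> b0 = 0 /\ b1 = 0.
Proof.
move=> /ker[r e].
have r0 : r = 0.
  apply/eqP; apply: contraT => nr.
  have := size_linear b0 b1; rewrite e size_monicM // size_p -(prednK (_ : 0 < size r)%N) ?addnS //.
  by rewrite lt0n size_poly_eq0.
move: e; rewrite r0 mulr0 => e; split.
  by have := congr1 (fun q : {poly {poly F}} => q`_0) e; rewrite /= coefD coefMX !coefC ?coef0 /= add0r.
by have := congr1 (fun q : {poly {poly F}} => q`_1) e; rewrite /= coefD coefMX !coefC ?coef0 /= addr0.
Qed.

(** Modulo p every polynomial is b0 + b1 y, and its product with the conjugate
b0 - b1 f - b1 y is the norm N = b0^2 - b0 b1 f + b1^2 g. It is nonzero because L is
a domain. Hence a function can vanish only above the roots of N. *)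
Lemma norm_exists a : eval2 iota x y a != 0 ->
  exists (N : {poly F}) c d, N != 0 /\ N%:P = a * c + p * d.
Proof.
move=> na; pose b := Pdiv.CommonRing.rmodp a p; pose Q := Pdiv.CommonRing.rdivp a p.
have ab : a = Q * p + b by exact: Pdiv.RingMonic.rdivp_eq monic_p a.
have sb : (size b <= 2)%N.
  by have := Pdiv.CommonRing.ltn_rmodpN0 a (monic_neq0 monic_p); rewrite size_p ltnS.
have be : b = (b`_1)%:P * 'X + (b`_0)%:P.
  apply/polyP => -[|[|i]]; rewrite coefD coefMX !coefC /= ?add0r ?addr0 //.
  by apply: nth_default; apply: leq_trans sb _.
set b0 := b`_0 in be; set b1 := b`_1 in be.
pose c := (b0 - b1 * f)%:P - b1%:P * 'X.
pose N := b0 * b0 - b0 * b1 * f + b1 * b1 * g.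
have Ne : N%:P = a * c + p * (b1%:P * b1%:P - Q * c).
  rewrite ab be /c /N /p !(polyCD, polyCN, polyCM); ring.
exists N, c, (b1%:P * b1%:P - Q * c); split=> //.
apply/eqP => N0; move: Ne; rewrite N0 => /(congr1 (eval2 iota x y)).
have ep : eval2 iota x y p = 0 by apply/ker; exists 1; rewrite mulr1.
rewrite polyC0 eval20 eval2D !eval2M ep mul0r addr0 => /esym/eqP.
rewrite mulf_eq0 (negPf na) /= => /eqP ec.
have : eval2 iota x y ((- b1)%:P * 'X + (b0 - b1 * f)%:P) = 0.
  by rewrite -ec /c; congr eval2; rewrite polyCN mulNr addrC.
move=> /linear_eq0[e0 /eqP]; rewrite oppr_eq0 => /eqP e1.
move: na; rewrite ab eval2D eval2M ep mulr0 add0r be.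
by move: e0; rewrite e1 mul0r subr0 => ->; rewrite polyC0 mul0r addr0 eval20 eqxx.
Qed.

End Norm.

(** * The Bloch-Wigner function *)

From Stdlib Require Import Reals Lra.
From Coquelicot Require Import Rcomplements Hierarchy Continuity Derive RInt RInt_analysis AutoDerive
  ElemFct.
(* [C] denotes again the complex numbers, no longer the binomial coefficients *)
Require Import Defs.
Delimit Scope R_scope with coqR.
Delimit Scope ring_scope with R.
Local Open Scope R_scope.

Definition C1_at (u u' : R -> R) (t : R) : Prop :=
  locally t (fun s => is_derive u s (u' s)) /\ continuous u' t.

Lemma C1_at_derive u u' t : C1_at u u' t -> is_derive u t (u' t).
Proof. by case=> /locally_singleton. Qed.

Lemma C1_at_continuous u u' t : C1_at u u' t -> continuous u t.
Proof.
by move=> /C1_at_derive h; apply: ex_derive_continuous; exists (u' t).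
Qed.

(** The form below has a singularity ln t at the origin of a segment. After t = s^2 it
becomes s ln(s^2), which is continuous at 0, and s^2 ln(s^2) is differentiable at 0,
so that integrals with these terms are proper. *)
Definition slog (s : R) : R := s * ln (s * s).

(** With q = sqrt |s|: ln q >= 1 - 1 / q, and ln(s^2) = 4 ln q. *)
Lemma slog_bound s : Rabs s <= 1 -> Rabs (slog s) <= 4 * sqrt (Rabs s).
Proof.
move=> s1; rewrite /slog.
have [->|s0] := Req_dec s 0.
  by rewrite Rmult_0_l Rabs_R0; have := sqrt_pos 0; lra.
have a0 : 0 < Rabs s by apply: Rabs_pos_lt.
have q0 := sqrt_lt_R0 _ a0; set q := sqrt (Rabs s) in q0 *.
have aq : Rabs s = q * q by rewrite sqrt_def //; lra.
have q1 : q <= 1 by rewrite -sqrt_1; apply: sqrt_le_1_alt.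
have lq0 : ln q <= 0.
  by rewrite -ln_1; case: q1 => [q1|->]; [left; apply: ln_increasing | right].
have lq : - ln q <= / q - 1.
  rewrite -ln_Rinv //.
  have h := exp_ineq1_le (ln (/ q)); rewrite exp_ln in h; last exact: Rinv_0_lt_compat.
  lra.
have -> : s * s = q * q * (q * q).
  by rewrite -aq -Rabs_mult Rabs_right //; nra.
rewrite !ln_mult; [|nra..].
rewrite Rabs_mult aq (Rabs_left1 (_ + _)); last by lra.
have e : q * / q = 1 by field; lra.
nra.
Qed.

Lemma slog_continuous s : continuous slog s.
Proof.
have [->|s0] := Req_dec s 0; last first.
  apply: ex_derive_continuous; rewrite /slog; auto_derive; nra.
have s00 : slog 0 = 0 by rewrite /slog Rmult_0_l.
apply/continuity_pt_filterlim; rewrite /continuity_pt /continue_in /limit1_in /limit_in /=.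
move=> e e0; exists (Rmin 1 (e / 5 * (e / 5))); split.
  by apply: Rmin_Rgt_r; split; nra.
move=> x [_]; rewrite /R_dist s00 !Rminus_0_r => xd.
have x1 : Rabs x <= 1 by have := Rmin_l 1 (e / 5 * (e / 5)); lra.
have x2 : Rabs x <= e / 5 * (e / 5) by have := Rmin_r 1 (e / 5 * (e / 5)); lra.
have h := slog_bound x1.
have : sqrt (Rabs x) <= e / 5.
  by rewrite -(sqrt_square (e / 5)); [apply: sqrt_le_1_alt | lra].
lra.
Qed.

(** At 0 the difference quotient is [slog] itself. *)
Lemma is_derive_sslog s :
  is_derive (fun s => s * slog s) s (2 * slog s + 2 * s).
Proof.
have [->|s0] := Req_dec s 0; last first.
  by rewrite /slog; auto_derive; [nra | field].
have s00 : slog 0 = 0 by rewrite /slog Rmult_0_l.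
rewrite s00; apply/is_derive_Reals => e e0.
have /continuity_pt_filterlim c0 : continuous slog (0 : R) by exact: slog_continuous.
have [d [d0 hd]] := c0 e e0;
 exists (mkposreal d d0) => h h0 hh.
have := hd h; rewrite /= /R_dist s00 Rminus_0_r => hd'.
have -> : ((0 + h) * slog (0 + h) - 0 * 0) / h - (2 * 0 + 2 * 0) = slog h - 0.
  by rewrite Rplus_0_l; field.
apply: hd'; split=> //; split=> //; lra.
Qed.

(** The value of ln|z| d arg(1 - z) - ln|1 - z| d arg z on the tangent vector
(u', v') at z = u + i v. *)
Definition bw_form (u v u' v' : R) : R :=
  / 2 * ln (u * u + v * v)
    * (- ((1 - u) * v' + v * u') / ((1 - u) * (1 - u) + v * v))
  - / 2 * ln ((1 - u) * (1 - u) + v * v)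
    * ((u * v' - v * u') / (u * u + v * v)).

(** |1 - s^2 z|^2 for z = u + i v. *)
Definition ray_norm (u v s : R) := 1 - 2 * s * s * u + s * s * s * s * (u * u + v * v).

(** The integral of the above form along the segment from 0 to z, parametrized by
s^2 z. On it arg z is constant, and d arg(1 - s^2 z) = - 2 s v / |1 - s^2 z|^2 ds.
For real z the integrand is 0, whether or not the segment passes through 1. *)
Definition BW_ray (u v : R) : R :=
  RInt (fun s => -2 * (slog s + s * (/ 2 * ln (u * u + v * v))) * v / ray_norm u v s) 0 1.

(** z is not on the half-line [1, oo), so that the segment from 0 to z avoids 1. *)
Definition off_ray (u v : R) := u < 1 \/ v <> 0.

Lemma ray_norm_gt0 u v s : 0 <= s <= 1 -> off_ray u v -> 0 < ray_norm u v s.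
Proof.
move=> s01 o.
have -> : ray_norm u v s = (1 - s * s * u) * (1 - s * s * u) + (s * s * v) * (s * s * v).
  by rewrite /ray_norm; ring.
have [q0 q1] : 0 <= s * s <= 1 by nra.
set q := s * s in q0 q1 *; case: o => h.
  suff : 0 < 1 - q * u by nra.
  have [|] := Rle_dec u 0; nra.
have [->|q2] := Req_dec q 0; first by lra.
have : 0 < (q * v) * (q * v).
  by apply: Rsqr_pos_lt; apply: Rmult_integral_contrapositive_currified.
have := Rle_0_sqr (1 - q * u); rewrite /Rsqr; lra.
Qed.

Lemma off_ray_locally (u v : R -> R) t : continuous u t -> continuous v t ->
  off_ray (u t) (v t) -> locally t (fun s => off_ray (u s) (v s)).
Proof.
move=> cu cv [h|h].
  have := cu (fun x => x < 1) (open_lt 1 (u t) h).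
  by apply: (filter_imp (F := locally t)) => s hs; left.
have := cv (fun x => x <> 0) (open_neq 0 (v t) h).
by apply: (filter_imp (F := locally t)) => s hs; right.
Qed.

Lemma abs2_gt0 u v : u <> 0 \/ v <> 0 -> 0 < u * u + v * v.
Proof. case=> h; have := Rsqr_pos_lt _ h; rewrite /Rsqr; nra. Qed.

Lemma neq0_locally (u v : R -> R) t : continuous u t -> continuous v t ->
  u t <> 0 \/ v t <> 0 -> locally t (fun s => u s <> 0 \/ v s <> 0).
Proof.
move=> cu cv [h|h].
  have := cu (fun x => x <> 0) (open_neq 0 (u t) h).
  by apply: (filter_imp (F := locally t)) => s hs; left.
have := cv (fun x => x <> 0) (open_neq 0 (v t) h).
by apply: (filter_imp (F := locally t)) => s hs; right.
Qed.

(** Pull the form back to the rectangle by (t, s) |-> s^2 z(t): it is K ds + M dt, and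
being closed it satisfies dK/dt = dM/ds = K'. *)
Section Ray.
Variables (u u' v v' : R -> R).

Let K t s := -2 * (slog s + s * (/ 2 * ln (u t * u t + v t * v t))) * v t
             / ray_norm (u t) (v t) s.
Let l t := / 2 * ln (u t * u t + v t * v t).
Let l' t := (u t * u' t + v t * v' t) / (u t * u t + v t * v t).
Let N t s := ray_norm (u t) (v t) s.
Let N' t s := - 2 * s * s * u' t + 2 * (s * s * s * s) * (u t * u' t + v t * v' t).
Let K' t s := -2 * (s * l' t * v t / N t s
  + (slog s + s * l t) * (v' t / N t s - v t * N' t s / (N t s * N t s))).

Lemma BW_ray_integrand_derive t s : 
  is_derive u t (u' t) -> is_derive v t (v' t) ->
  u t <> 0 \/ v t <> 0 -> ray_norm (u t) (v t) s <> 0 ->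
  is_derive (fun t => K t s) t (K' t s).
Proof.
move=> du dv /abs2_gt0 nz N0; rewrite /K /K' /ray_norm.
have [eu ev] : ex_derive u t /\ ex_derive v t by split; [exists (u' t)|exists (v' t)].
have Du : Derive (fun x => u x) t = u' t by apply: is_derive_unique.
have Dv : Derive (fun x => v x) t = v' t by apply: is_derive_unique.
rewrite /ray_norm in N0.
auto_derive; first by do ?split => //; move=> h; apply: N0; rewrite -h; ring.
rewrite Du Dv /N' /l' /l /N /ray_norm; field; split=> //; lra.
Qed.

Let P t s := - ((1 - s * s * u t) * v' t + s * s * v t * u' t) / N t s.
Let Q t := (u t * v' t - v t * u' t) / (u t * u t + v t * v t).
Let M t s := (s * slog s + s * s * l t) * P t s - / 2 * ln (N t s) * Q t.

Lemma BW_ray_flux_derive t s :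
  u t <> 0 \/ v t <> 0 -> 0 < ray_norm (u t) (v t) s ->
  is_derive (M t) s (K' t s).
Proof.
move=> /abs2_gt0 nz N0.
pose P' := (2 * s * (u t * v' t - v t * u' t) * N t s
  + ((1 - s * s * u t) * v' t + s * s * v t * u' t)
    * (- 4 * s * u t + 4 * (s * s * s) * (u t * u t + v t * v t)))
  / (N t s * N t s).
have dP : is_derive (P t) s P'.
  rewrite /P /P' /N; rewrite /ray_norm in N0 *.
  by auto_derive; [lra | field; lra].
pose T' := 2 * s * l t * P t s + s * s * l t * P'
  - / 2 * ((- 4 * s * u t + 4 * (s * s * s) * (u t * u t + v t * v t)) / N t s) * Q t.
have dT : is_derive (fun s => s * s * l t * P t s - / 2 * ln (N t s) * Q t) s T'.
  have eP : ex_derive (P t) s by exists P'.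
  have DP : Derive (fun x => P t x) s = P' by apply: is_derive_unique.
  rewrite /T' /N; rewrite /ray_norm in N0 *.
  by auto_derive; [split=> //; lra | rewrite DP; field; lra].
have dE := is_derive_plus _ _ _ _ _
  (is_derive_mult _ _ _ _ _ (is_derive_sslog s) dP Rmult_comm) dT.
apply: is_derive_ext; last first.
  have -> : K' t s = plus (plus (mult (2 * slog s + 2 * s) (P t s))
                                (mult (s * slog s) P')) T'; last exact: dE.
  rewrite /plus /mult /= /K' /T' /P' /P /Q /l' /N' /N; rewrite /ray_norm in N0 *.
  by field; lra.
by move=> x; rewrite /plus /mult /= /M; ring.
Qed.

Lemma continuous_2d1 (f : R -> R) t s :
  continuous f t -> continuity_2d_pt (fun x _ => f x) t s.
Proof.
move=> /continuity_pt_filterlim cf.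
by apply: (@continuity_1d_2d_pt_comp f (fun x _ => x));
  [exact: cf | exact: continuity_2d_pt_id1].
Qed.

Lemma continuous_2d2 (f : R -> R) t s :
  continuous f s -> continuity_2d_pt (fun _ x => f x) t s.
Proof.
move=> /continuity_pt_filterlim cf.
by apply: (@continuity_1d_2d_pt_comp f (fun _ x => x));
  [exact: cf | exact: continuity_2d_pt_id2].
Qed.

Lemma locally_2d_fst (A : R -> Prop) t s :
  locally t A -> locally_2d (fun x _ => A x) t s.
Proof. by case=> d hd; exists d => x y hx _; apply: hd. Qed.

Lemma continuity_2d_pt_slice (f : R -> R -> R) t s :
  continuity_2d_pt f t s -> continuous (f t) s.
Proof.
move=> h; apply/continuity_pt_filterlim => e e0.
have [d hd] := h (mkposreal e e0); exists d; split; first exact: cond_pos.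
move=> x [_ xd]; apply: hd => //.
by rewrite /Rminus Rplus_opp_r Rabs_R0; apply: cond_pos.
Qed.

(** Differentiate under the integral sign: the derivative is the integral of K' = dM/ds,
that is M(1) - M(0), and M(0) = 0 while M(1) is the form at z(t). *)
Lemma BW_ray_derive t : C1_at u u' t -> C1_at v v' t ->
  u t <> 0 \/ v t <> 0 -> off_ray (u t) (v t) ->
  is_derive (fun t => BW_ray (u t) (v t)) t (bw_form (u t) (v t) (u' t) (v' t)).
Proof.
move=> Cu Cv nz off.
have [cu cv] := (C1_at_continuous Cu, C1_at_continuous Cv).
have loff := off_ray_locally cu cv off.
have lnz := neq0_locally cu cv nz.
have [[ldu cu'] [ldv cv']] := (Cu, Cv).
have c2 (s : R) : continuity_2d_pt (fun _ x => x) t s by apply: continuity_2d_pt_id2.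
have cN s : continuity_2d_pt N t s.
  rewrite /N /ray_norm.
  by repeat first [exact: c2 | apply: continuous_2d1; (exact: cu || exact: cv)
   | apply: continuity_2d_pt_plus | apply: continuity_2d_pt_opp
   | apply: continuity_2d_pt_mult | apply: continuity_2d_pt_const].
have cn : continuous (fun t => u t * u t + v t * v t) t.
  by apply: continuous_plus; apply: continuous_mult.
have cl : continuous l t.
  apply: (continuous_scal_r (/ 2) (fun t => ln (u t * u t + v t * v t))).
  apply: continuous_comp; first exact: cn.
  by apply: continuous_ln; apply: abs2_gt0.
have cl' : continuous l' t.
  apply: continuous_mult; first by apply: continuous_plus; apply: continuous_mult.
  by apply: continuous_Rinv_comp => //; have := abs2_gt0 nz; lra.
have cK' s : 0 <= s <= 1 -> continuity_2d_pt K' t s.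
  move=> s01; have N0 : N t s <> 0 by have := ray_norm_gt0 s01 off; rewrite /N; lra.
  have NN : N t s * N t s <> 0 by exact: Rmult_integral_contrapositive_currified.
  rewrite /K' /N' /Rdiv.
  by repeat first [exact: c2 | exact: cN | exact: N0 | exact: NN
   | apply: continuous_2d1; first [exact: cu | exact: cv | exact: cu' | exact: cv' | exact: cl | exact: cl']
   | apply: continuous_2d2; exact: slog_continuous
   | apply: continuity_2d_pt_plus | apply: continuity_2d_pt_opp
   | apply: continuity_2d_pt_mult | apply: continuity_2d_pt_inv | apply: continuity_2d_pt_const].
have K'E : locally t (fun x => forall s, 0 <= s <= 1 -> is_derive (fun t => K t s) x (K' x s)).
  refine (filter_imp _ _ _ (filter_and _ _ (filter_and _ _ ldu ldv) (filter_and _ _ lnz loff))).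
  move=> x [[du dv] [nzx offx]] s s01.
  apply: BW_ray_integrand_derive => //.
  by have := ray_norm_gt0 s01 offx; lra.
have m01 s : Rmin 0 1 <= s <= Rmax 0 1 -> 0 <= s <= 1.
  by rewrite Rmin_left ?Rmax_right; lra.
have main : is_derive (fun t => BW_ray (u t) (v t)) t
    (RInt (fun s => Derive (fun t => K t s) t) 0 1).
  apply: is_derive_RInt_param.
  - refine (filter_imp _ _ _ K'E) => x h s /m01 /h h'.
    by exists (K' x s).
  - move=> s /m01 s01; apply: continuity_2d_pt_ext_loc (cK' _ s01).
    have N0 : N t s <> 0 by have := ray_norm_gt0 s01 off; rewrite /N; lra.
    have := locally_2d_and _ _ _ _ (continuity_2d_pt_neq_0 _ _ _ (cN s) N0)
      (locally_2d_fst s (filter_and _ _ (filter_and _ _ ldu ldv) lnz)).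
    case=> d hd; exists d => x y hx hy.
    have [Nx [[du dv] nzx]] := hd x y hx hy; symmetry; apply: is_derive_unique.
    exact: BW_ray_integrand_derive.
  - refine (filter_imp _ _ _ loff) => x offx.
    apply: ex_RInt_continuous => s /m01 s01.
    apply: continuous_mult; last apply: continuous_Rinv_comp.
    + apply: continuous_mult; last exact: continuous_const.
      apply: continuous_mult; first exact: continuous_const.
      apply: continuous_plus; first exact: slog_continuous.
      by apply: continuous_mult; [exact: continuous_id | exact: continuous_const].
    + by apply: ex_derive_continuous; rewrite /ray_norm; auto_derive.
    + by have := ray_norm_gt0 s01 offx; lra.
have KM s : 0 <= s <= 1 -> Derive (fun t => K t s) t = K' t s.
  by move=> s01; apply: is_derive_unique; apply: (locally_singleton _ _ K'E).
have <- : RInt (fun s => Derive (fun t => K t s) t) 0 1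
    = bw_form (u t) (v t) (u' t) (v' t); last by [].
have -> : bw_form (u t) (v t) (u' t) (v' t) = minus (M t 1) (M t 0).
  rewrite /minus /plus /opp /= /M /slog /N /ray_norm /P /N /ray_norm /Q /l.
  rewrite !(Rmult_0_l, Rmult_0_r, Rmult_1_l, Rmult_1_r, ln_1, Rminus_0_r, Rplus_0_l) .
  rewrite /bw_form Rplus_0_r ln_1.
  have -> : 1 - 2 * u t + (u t * u t + v t * v t)
    = (1 - u t) * (1 - u t) + v t * v t by ring.
  by rewrite Rmult_0_r; ring.
apply: is_RInt_unique; apply: is_RInt_ext; last apply: is_RInt_derive.
- move=> s; rewrite Rmin_left ?Rmax_right; try lra; move=> h.
  symmetry; apply: KM; lra.
- move=> s /m01 s01; apply: BW_ray_flux_derive => //; exact: ray_norm_gt0.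
- move=> s /m01 s01; exact: continuity_2d_pt_slice (cK' _ s01).
Qed.

End Ray.

Lemma BW_ray_real u : BW_ray u 0 = 0.
Proof.
rewrite /BW_ray (RInt_ext _ (fun _ => 0)); first by rewrite RInt_const scal_zero_r.
by move=> s _; rewrite Rmult_0_r /Rdiv Rmult_0_l.
Qed.

(** Real and imaginary parts of 1 / z, and their derivatives along a curve. *)
Definition invu (u v : R) := u / (u * u + v * v).
Definition invv (u v : R) := - v / (u * u + v * v).
Definition invu' (u v u' v' : R) :=
  (u' * (u * u + v * v) - u * (2 * (u * u' + v * v'))) / ((u * u + v * v) * (u * u + v * v)).
Definition invv' (u v u' v' : R) :=
  (- v' * (u * u + v * v) + v * (2 * (u * u' + v * v'))) / ((u * u + v * v) * (u * u + v * v)).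

Section C1.
Variables (u u' v v' : R -> R) (t : R).
Hypotheses (Cu : C1_at u u' t) (Cv : C1_at v v' t).
Hypothesis nz : u t <> 0 \/ v t <> 0.

Let cabs2 : continuous (fun t => u t * u t + v t * v t) t.
Proof.
have [cu cv] := (C1_at_continuous Cu, C1_at_continuous Cv).
by apply: continuous_plus; apply: continuous_mult.
Qed.

Let cnum (f g f' g' : R -> R) : continuous f t -> continuous g t ->
  continuous f' t -> continuous g' t ->
  continuous (fun t => f' t * (u t * u t + v t * v t) - g t * (2 * (u t * u' t + v t * v' t))) t.
Proof.
move=> cf cg cf' cg'.
have [[cu cv] [[_ cu'] [_ cv']]] := ((C1_at_continuous Cu, C1_at_continuous Cv), (Cu, Cv)).
apply: continuous_minus; apply: continuous_mult => //.
apply: continuous_mult; first exact: continuous_const.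
by apply: continuous_plus; apply: continuous_mult.
Qed.

Let cden : continuous (fun t => / ((u t * u t + v t * v t) * (u t * u t + v t * v t))) t.
Proof.
apply: continuous_Rinv_comp; first by apply: continuous_mult.
by have := abs2_gt0 nz; nra.
Qed.

Lemma C1_at_invu :
  C1_at (fun t => invu (u t) (v t)) (fun t => invu' (u t) (v t) (u' t) (v' t)) t.
Proof.
have [[cu cv] [[ldu cu'] [ldv cv']]] := ((C1_at_continuous Cu, C1_at_continuous Cv), (Cu, Cv)).
split.
  refine (filter_imp _ _ _ (filter_and _ _ (filter_and _ _ ldu ldv) (neq0_locally cu cv nz))).
  move=> s [[du dv] /abs2_gt0 nzs].
  have [eu ev] : ex_derive u s /\ ex_derive v s by split; [exists (u' s)|exists (v' s)].
  have Du : Derive (fun x => u x) s = u' s by apply: is_derive_unique.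
  have Dv : Derive (fun x => v x) s = v' s by apply: is_derive_unique.
  rewrite /invu /invu'; auto_derive; first by do ?split => //; lra.
  by rewrite Du Dv; field; lra.
apply: continuous_mult => //.
exact: (@cnum v u u' v').
Qed.

Lemma C1_at_invv :
  C1_at (fun t => invv (u t) (v t)) (fun t => invv' (u t) (v t) (u' t) (v' t)) t.
Proof.
have [[cu cv] [[ldu cu'] [ldv cv']]] := ((C1_at_continuous Cu, C1_at_continuous Cv), (Cu, Cv)).
split.
  refine (filter_imp _ _ _ (filter_and _ _ (filter_and _ _ ldu ldv) (neq0_locally cu cv nz))).
  move=> s [[du dv] /abs2_gt0 nzs].
  have [eu ev] : ex_derive u s /\ ex_derive v s by split; [exists (u' s)|exists (v' s)].
  have Du : Derive (fun x => u x) s = u' s by apply: is_derive_unique.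
  have Dv : Derive (fun x => v x) s = v' s by apply: is_derive_unique.
  rewrite /invv /invv'; auto_derive; first by do ?split => //; lra.
  by rewrite Du Dv; field; lra.
apply: continuous_mult => //.
have e x : - (v' x * (u x * u x + v x * v x) - v x * (2 * (u x * u' x + v x * v' x)))
    = - v' x * (u x * u x + v x * v x) + v x * (2 * (u x * u' x + v x * v' x)) by ring.
apply: (continuous_ext _ _ _ e).
by apply: (continuous_opp (V := R_NormedModule)); exact: (@cnum v v v' v').
Qed.

End C1.

Lemma inv_abs2 u v : u <> 0 \/ v <> 0 ->
  invu u v * invu u v + invv u v * invv u v = / (u * u + v * v).
Proof. by move=> /abs2_gt0 nz; rewrite /invu /invv; field; lra. Qed.

Lemma inv_neq0 u v : u <> 0 \/ v <> 0 -> invu u v <> 0 \/ invv u v <> 0.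
Proof.
move=> nz; have := Rinv_0_lt_compat _ (abs2_gt0 nz); rewrite -inv_abs2 // => h.
have [e|] := Req_dec (invu u v) 0; last by left.
by right => e'; rewrite e e' in h; lra.
Qed.

(** {1/z, 1 - 1/z} = - {z, 1 - z} up to symbols with -1, on which the form is 0. *)
Lemma bw_form_inv u v u' v' : u <> 0 \/ v <> 0 -> 1 - u <> 0 \/ v <> 0 ->
  bw_form (invu u v) (invv u v) (invu' u v u' v') (invv' u v u' v') = - bw_form u v u' v'.
Proof.
move=> nz nz1; have n0 := abs2_gt0 nz; have n1 := abs2_gt0 nz1.
rewrite /bw_form inv_abs2 // ln_Rinv //.
have -> : (1 - invu u v) * (1 - invu u v) + invv u v * invv u v
  = ((1 - u) * (1 - u) + v * v) * / (u * u + v * v).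
  by rewrite /invu /invv; field; lra.
rewrite ln_mult ?ln_Rinv //; last exact: Rinv_0_lt_compat.
rewrite /invu /invv /invu' /invv'; field; split; lra.
Qed.

Lemma C1_at_affine a b t : C1_at (fun s => a + s * b) (fun _ => b) t.
Proof.
split; last exact: continuous_const.
by apply: filter_forall => s; auto_derive => //; ring.
Qed.

(** Off the half-line [0, oo) both sides are differentiable with the same differential;
join z to -1, where both vanish, by a segment. On the half-line both sides are 0. *)
Lemma BW_ray_inv u v : u <> 0 \/ v <> 0 -> BW_ray u v = - BW_ray (invu u v) (invv u v).
Proof.
move=> nz; have [v0|v0] := Req_dec v 0.
  by rewrite v0 /invv Ropp_0 /Rdiv Rmult_0_l !BW_ray_real Ropp_0.
pose a s := -1 + s * (u + 1); pose b s := 0 + s * v.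
have off s : 0 <= s -> a s < 0 \/ b s <> 0.
  move=> s0; have [->|s1] := Req_dec s 0; [left|right]; rewrite /a /b; first lra.
  by rewrite Rplus_0_l; apply: Rmult_integral_contrapositive_currified.
have nzab s : 0 <= s -> a s <> 0 \/ b s <> 0.
  by move=> /off [|]; [left; lra | right].
pose h s := BW_ray (a s) (b s) + BW_ray (invu (a s) (b s)) (invv (a s) (b s)).
have dh s : 0 <= s -> is_derive h s 0.
  move=> s0; have [Ca Cb] := (C1_at_affine (-1) (u + 1) s, C1_at_affine 0 v s).
  have nzs := nzab s s0; have n0 := abs2_gt0 nzs.
  have d1 : is_derive (fun s => BW_ray (a s) (b s)) s (bw_form (a s) (b s) (u + 1) v).
    apply: (BW_ray_derive Ca Cb nzs); case: (off s s0); rewrite -/(a s) -/(b s);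
      [by left; lra | by right].
  have d2 : is_derive (fun s => BW_ray (invu (a s) (b s)) (invv (a s) (b s))) s
      (bw_form (invu (a s) (b s)) (invv (a s) (b s))
         (invu' (a s) (b s) (u + 1) v) (invv' (a s) (b s) (u + 1) v)).
    apply: (BW_ray_derive (C1_at_invu Ca Cb nzs) (C1_at_invv Ca Cb nzs)).
      exact: inv_neq0.
    rewrite -/(a s) -/(b s); case: (off s s0) => hs; [left|right]; rewrite /invu /invv.
      have := Rinv_0_lt_compat _ n0; rewrite /Rdiv; nra.
    apply: Rmult_integral_contrapositive_currified; first exact: Ropp_neq_0_compat.
    by apply: Rinv_neq_0_compat; lra.
  apply: (is_derive_ext (fun s => plus (BW_ray (a s) (b s))
    (BW_ray (invu (a s) (b s)) (invv (a s) (b s))))) => //.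
  have e := is_derive_plus _ _ _ _ _ d1 d2.
  rewrite bw_form_inv in e => //; last by case: (off s s0); rewrite /a /b; [left; lra | right].
  by rewrite /plus /= Rplus_opp_r in e.
have : is_RInt (fun _ => 0) 0 1 (minus (h 1) (h 0)).
  apply: is_RInt_derive => s; rewrite Rmin_left ?Rmax_right; try lra; move=> [s0 _].
    exact: dh.
  exact: continuous_const.
move=> /is_RInt_unique; rewrite RInt_const scal_zero_r /minus /plus /opp /= /h.
have -> : a 1 = u by rewrite /a; ring.
have -> : b 1 = v by rewrite /b; ring.
have -> : b 0 = 0 by rewrite /b; ring.
have -> : invv (a 0) 0 = 0 by rewrite /invv Ropp_0 /Rdiv Rmult_0_l.
rewrite !BW_ray_real /zero /=; lra.
Qed.

(** Near a point of (1, oo) use the inversion formula: 1/z is off [1, oo). *)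
Lemma BW_derive (u u' v v' : R -> R) t : C1_at u u' t -> C1_at v v' t ->
  u t <> 0 \/ v t <> 0 -> 1 - u t <> 0 \/ v t <> 0 ->
  is_derive (fun t => BW_ray (u t) (v t)) t (bw_form (u t) (v t) (u' t) (v' t)).
Proof.
move=> Cu Cv nz nz1.
have [v0|v0] := Req_dec (v t) 0; last by apply: BW_ray_derive => //; right.
have [u1|u1] := Rlt_dec (u t) 1; first by apply: BW_ray_derive => //; left.
have u2 : 1 < u t.
  case: nz1 => [h|/(_ v0) //]; have [//|[e|]] := Rtotal_order 1 (u t); last by move=> ?; lra.
  by case: h; rewrite -e; ring.
apply: (is_derive_ext_loc (fun t => opp (BW_ray (invu (u t) (v t)) (invv (u t) (v t))))).
  refine (filter_imp _ _ _ (neq0_locally (C1_at_continuous Cu) (C1_at_continuous Cv) nz)).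
  by move=> s nzs; rewrite (BW_ray_inv nzs).
rewrite -[bw_form _ _ _ _]Ropp_involutive -bw_form_inv //.
apply: is_derive_opp.
have i0 := Rinv_0_lt_compat (u t).
have i1 : / u t < 1 by rewrite -Rinv_1; apply: Rinv_lt_contravar; lra.
have e : invu (u t) (v t) = / u t by rewrite /invu v0; field; lra.
apply: (BW_ray_derive (C1_at_invu Cu Cv nz) (C1_at_invv Cu Cv nz)); left; lra.
Qed.

Lemma ln_abs2_continuous (u v : R -> R) t : continuous u t -> continuous v t ->
  u t <> 0 \/ v t <> 0 -> continuous (fun t => ln (u t * u t + v t * v t)) t.
Proof.
move=> cu cv nz; apply: continuous_comp; last by apply: continuous_ln; apply: abs2_gt0.
by apply: continuous_plus; apply: continuous_mult.
Qed.


Lemma C1_at_const c t : C1_at (fun _ => c) (fun _ => 0) t.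
Proof.
split; last exact: continuous_const.
by apply: filter_forall => s; apply: is_derive_const.
Qed.

Section C1Operations.
Variables (f f' g g' : R -> R) (t : R).
Hypotheses (Cf : C1_at f f' t) (Cg : C1_at g g' t).

Lemma C1_at_plus : C1_at (fun s => f s + g s) (fun s => f' s + g' s) t.
Proof.
case: Cf => df cf; case: Cg => dg cg; split; last exact: continuous_plus.
refine (filter_imp _ _ _ (filter_and _ _ df dg)) => s [dfs dgs].
exact: is_derive_plus.
Qed.

Lemma C1_at_opp : C1_at (fun s => - f s) (fun s => - f' s) t.
Proof.
case: Cf => df cf; split; last exact: (continuous_opp (V := R_NormedModule)).
by refine (filter_imp _ _ _ df) => s dfs; apply: is_derive_opp.
Qed.

Lemma C1_at_mult : C1_at (fun s => f s * g s) (fun s => f' s * g s + f s * g' s) t.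
Proof.
have [cf cg] := (C1_at_continuous Cf, C1_at_continuous Cg).
case: Cf => df cf'; case: Cg => dg cg'; split.
  refine (filter_imp _ _ _ (filter_and _ _ df dg)) => s [dfs dgs].
  exact: (is_derive_mult _ _ _ _ _ dfs dgs Rmult_comm).
by apply: continuous_plus; apply: continuous_mult.
Qed.

Lemma C1_at_sqrt : 0 < f t ->
  C1_at (fun s => sqrt (f s)) (fun s => f' s / (2 * sqrt (f s))) t.
Proof.
move=> f0; have cf := C1_at_continuous Cf; case: Cf => df cf'; split.
  refine (filter_imp _ _ _ (filter_and _ _ df (cf _ (open_gt 0 (f t) f0)))) => s [dfs fs0].
  have ef : ex_derive f s by exists (f' s).
  have Df : Derive (fun x => f x) s = f' s by apply: is_derive_unique.
  have q0 := sqrt_lt_R0 _ fs0.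
  by auto_derive => //; rewrite Df; field; lra.
apply: continuous_mult => //; apply: continuous_Rinv_comp; last first.
  by have := sqrt_lt_R0 _ f0; lra.
apply: continuous_mult; first exact: continuous_const.
by apply: continuous_comp => //; apply: continuous_sqrt.
Qed.

Lemma C1_at_Rinv : f t <> 0 -> C1_at (fun s => / f s) (fun s => - f' s / (f s * f s)) t.
Proof.
move=> f0; have cf := C1_at_continuous Cf; case: Cf => df cf'; split.
  refine (filter_imp _ _ _ (filter_and _ _ df (cf _ (open_neq 0 (f t) f0)))) => s [dfs fs0].
  have ef : ex_derive f s by exists (f' s).
  have Df : Derive (fun x => f x) s = f' s by apply: is_derive_unique.
  by auto_derive => //; rewrite Df; field.
apply: continuous_mult; first exact: (continuous_opp (V := R_NormedModule)).
apply: continuous_Rinv_comp; first exact: continuous_mult.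
exact: Rmult_integral_contrapositive_currified.
Qed.

Lemma C1_at_eq : C1_at f (Derive f) t.
Proof.
case: Cf => df cf'; split.
  refine (filter_imp _ _ _ df) => s dfs; apply: Derive_correct; by exists (f' s).
apply: (continuous_ext_loc _ f') => //.
by refine (filter_imp _ _ _ df) => s dfs; symmetry; apply: is_derive_unique.
Qed.

End C1Operations.

Lemma C1_at_cos t : C1_at cos (fun s => - sin s) t.
Proof.
split; first by apply: filter_forall => s; apply: is_derive_cos.
by apply: (continuous_opp (V := R_NormedModule)); apply: continuous_sin.
Qed.

Lemma C1_at_sin t : C1_at sin cos t.
Proof.
split; first by apply: filter_forall => s; apply: is_derive_sin.
exact: continuous_cos.
Qed.

(** The functions ln|z| and d arg z of z = u + i v and of its derivative. *)
Definition lnabs (u v : R) : R := / 2 * ln (u * u + v * v).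
Definition darg (u v u' v' : R) : R := (u * v' - v * u') / (u * u + v * v).

Lemma bw_formE u v u' v' : bw_form u v u' v'
  = lnabs u v * darg (1 - u) (- v) (- u') (- v') - lnabs (1 - u) (- v) * darg u v u' v'.
Proof.
rewrite /bw_form /lnabs /darg.
have -> : - v * - v = v * v by ring.
by have -> : (1 - u) * - v' - - v * - u' = - ((1 - u) * v' + v * u') by ring.
Qed.

Lemma lnabs_mult u v s t : u <> 0 \/ v <> 0 -> s <> 0 \/ t <> 0 ->
  lnabs (u * s - v * t) (u * t + v * s) = lnabs u v + lnabs s t.
Proof.
move=> /abs2_gt0 nz /abs2_gt0 nz'; rewrite /lnabs -Rmult_plus_distr_l -ln_mult //.
by congr (_ * ln _); ring.
Qed.

Lemma darg_mult u v s t u' v' s' t' : u <> 0 \/ v <> 0 -> s <> 0 \/ t <> 0 ->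
  darg (u * s - v * t) (u * t + v * s)
    ((u' * s + u * s') - (v' * t + v * t')) ((u' * t + u * t') + (v' * s + v * s'))
  = darg u v u' v' + darg s t s' t'.
Proof.
move=> /abs2_gt0 nz /abs2_gt0 nz'; rewrite /darg.
have e : (u * s - v * t) * (u * s - v * t) + (u * t + v * s) * (u * t + v * s)
  = (u * u + v * v) * (s * s + t * t) by ring.
rewrite e; field; lra.
Qed.

Section Continuity.
Variables (u u' v v' : R -> R) (t : R).
Hypotheses (Cu : C1_at u u' t) (Cv : C1_at v v' t).
Hypothesis nz : u t <> 0 \/ v t <> 0.

Lemma lnabs_continuous : continuous (fun t => lnabs (u t) (v t)) t.
Proof.
have [cu cv] := (C1_at_continuous Cu, C1_at_continuous Cv).
apply: continuous_mult; first exact: continuous_const.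
exact: ln_abs2_continuous.
Qed.

Lemma darg_continuous : continuous (fun t => darg (u t) (v t) (u' t) (v' t)) t.
Proof.
have [[cu cv] [[_ cu'] [_ cv']]] := ((C1_at_continuous Cu, C1_at_continuous Cv), (Cu, Cv)).
apply: continuous_mult; first by apply: continuous_minus; apply: continuous_mult.
apply: continuous_Rinv_comp; first by apply: continuous_plus; apply: continuous_mult.
by have := abs2_gt0 nz; lra.
Qed.

End Continuity.

Lemma RInt_derive_closed (f df : R -> R) a b : (forall t, is_derive f t (df t)) ->
  (forall t, continuous df t) -> f a = f b -> RInt df a b = 0.
Proof.
move=> dF cF e; have := is_RInt_derive f df a b (fun t _ => dF t) (fun t _ => cF t).
move=> /is_RInt_unique ->; rewrite e; exact: Rplus_opp_r.
Qed.

(** The integral of an exact form along a loop. *)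
Lemma steinberg_RInt (u u' v v' : R -> R) a b :
  (forall t, C1_at u u' t) -> (forall t, C1_at v v' t) ->
  (forall t, u t <> 0 \/ v t <> 0) -> (forall t, 1 - u t <> 0 \/ v t <> 0) ->
  u a = u b -> v a = v b ->
  RInt (fun t => bw_form (u t) (v t) (u' t) (v' t)) a b = 0.
Proof.
move=> Cu Cv nz nz1 eu ev.
apply: (@RInt_derive_closed (fun t => BW_ray (u t) (v t))) => [t|t|]; last by rewrite eu ev.
  exact: BW_derive.
apply: (continuous_ext (fun t => lnabs (u t) (v t)
    * darg (1 - u t) (- v t) (- u' t) (- v' t)
    - lnabs (1 - u t) (- v t) * darg (u t) (v t) (u' t) (v' t))).
  by move=> x; rewrite bw_formE.
have C1u : C1_at (fun t => 1 - u t) (fun t => - u' t) t.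
  have := C1_at_plus (C1_at_const 1 t) (C1_at_opp (Cu t)); rewrite /C1_at => -[h1 h2].
  split; last exact: (continuous_opp (V := R_NormedModule)) (proj2 (Cu t)).
  by refine (filter_imp _ _ _ h1) => s; rewrite Rplus_0_l.
have nz' : 1 - u t <> 0 \/ - v t <> 0.
  by case: (nz1 t); [left | right; apply: Ropp_neq_0_compat].
apply: continuous_minus; apply: continuous_mult.
- exact: lnabs_continuous.
- exact: (darg_continuous C1u (C1_at_opp (Cv t))).
- exact: (lnabs_continuous C1u (C1_at_opp (Cv t))).
- exact: darg_continuous.
Qed.

Definition dlnabs (u v u' v' : R) : R := (u * u' + v * v') / (u * u + v * v).

Lemma lnabs_derive (u v : R -> R) t du dv : is_derive u t du -> is_derive v t dv ->
  u t <> 0 \/ v t <> 0 ->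
  is_derive (fun t => lnabs (u t) (v t)) t (dlnabs (u t) (v t) du dv).
Proof.
move=> dr di /abs2_gt0 n0.
have er : ex_derive u t by exists du.
have ei : ex_derive v t by exists dv.
have Er : Derive (fun x => u x) t = du by apply: is_derive_unique.
have Ei : Derive (fun x => v x) t = dv by apply: is_derive_unique.
rewrite /lnabs /dlnabs; auto_derive; first by do ?split.
by rewrite Er Ei; field; lra.
Qed.

Lemma atan_derive (u v : R -> R) t du dv : is_derive u t du -> is_derive v t dv ->
  u t <> 0 -> is_derive (fun t => atan (v t / u t)) t (darg (u t) (v t) du dv).
Proof.
move=> dr di nr.
have er : ex_derive u t by exists du.
have ei : ex_derive v t by exists dv.
have Er : Derive (fun x => u x) t = du by apply: is_derive_unique.
have Ei : Derive (fun x => v x) t = dv by apply: is_derive_unique.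
have n0 : 0 < u t * u t + v t * v t by apply: abs2_gt0; left.
rewrite /darg; auto_derive; first by do ?split.
by rewrite Er Ei; field; repeat split => //; lra.
Qed.

Local Close Scope R_scope.

(** * The regulator pairing of two loops *)

Notation re := complex.Re. Notation im := complex.Im.

Lemma reD (z w : C) : re (z + w) = (re z + re w)%coqR. Proof. by case: z; case: w. Qed.
Lemma imD (z w : C) : im (z + w) = (im z + im w)%coqR. Proof. by case: z; case: w. Qed.
Lemma reN (z : C) : re (- z) = (- re z)%coqR. Proof. by case: z. Qed.
Lemma imN (z : C) : im (- z) = (- im z)%coqR. Proof. by case: z. Qed.
Lemma reM (z w : C) : re (z * w) = (re z * re w - im z * im w)%coqR.
Proof. by case: z; case: w. Qed.
Lemma imM (z w : C) : im (z * w) = (re z * im w + im z * re w)%coqR.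
Proof. by case: z => a b; case: w => c d. Qed.
Lemma neq0_reim (z : C) : z != 0 <-> (re z <> 0 \/ im z <> 0)%coqR.
Proof.
case: z => a b; rewrite eq_complex /= negb_and; split.
  by case/orP=> /eqP; [left | right].
by case=> /eqP h; rewrite h ?orbT.
Qed.
Lemma reV (z : C) : z != 0 -> re (z^-1) = invu (re z) (im z).
Proof.
move/neq0_reim/abs2_gt0; case: z => a b /= nz.
rewrite /GRing.inv /= /invu -RdivE !expr2 //.
Qed.
Lemma imV (z : C) : z != 0 -> im (z^-1) = invv (re z) (im z).
Proof.
move/neq0_reim/abs2_gt0; case: z => a b /= nz.
rewrite /GRing.inv /= /invv -RdivE !expr2.
exact: Ropp_mult_distr_l.
Qed.

Definition C1c (z z' : R -> C) : Prop := forall t,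
  C1_at (fun t => re (z t)) (fun t => re (z' t)) t /\
  C1_at (fun t => im (z t)) (fun t => im (z' t)) t.

Definition cderiv (z : R -> C) (t : R) : C :=
  (Derive (fun t => re (z t)) t +i* Derive (fun t => im (z t)) t)%C.

Definition smooth (z : R -> C) : Prop := C1c z (cderiv z).

Lemma C1c_cderiv z z' : C1c z z' -> cderiv z = z'.
Proof.
move=> h; apply: funext => t; have [/C1_at_derive hr /C1_at_derive hi] := h t.
rewrite /cderiv (is_derive_unique _ _ _ hr) (is_derive_unique _ _ _ hi).
by case: (z' t).
Qed.

Lemma C1c_smooth z z' : C1c z z' -> smooth z.
Proof. by move=> h; rewrite /smooth (C1c_cderiv h). Qed.

Lemma C1c_const c : C1c (fun _ => c) (fun _ => 0).
Proof. by move=> t; split; apply: C1_at_const. Qed.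

Lemma C1cD z z' w w' : C1c z z' -> C1c w w' ->
  C1c (fun t => z t + w t) (fun t => z' t + w' t).
Proof.
move=> hz hw t; have [[zr zi] [wr wi]] := (hz t, hw t); split.
  by under eq_fun do rewrite reD; under [X in C1_at _ X]eq_fun do rewrite reD; apply: C1_at_plus.
by under eq_fun do rewrite imD; under [X in C1_at _ X]eq_fun do rewrite imD; apply: C1_at_plus.
Qed.

Lemma C1cN z z' : C1c z z' -> C1c (fun t => - z t) (fun t => - z' t).
Proof.
move=> hz t; have [zr zi] := hz t; split.
  by under eq_fun do rewrite reN; under [X in C1_at _ X]eq_fun do rewrite reN; apply: C1_at_opp.
by under eq_fun do rewrite imN; under [X in C1_at _ X]eq_fun do rewrite imN; apply: C1_at_opp.
Qed.

Lemma C1cM z z' w w' : C1c z z' -> C1c w w' ->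
  C1c (fun t => z t * w t) (fun t => z' t * w t + z t * w' t).
Proof.
move=> hz hw t; have [[zr zi] [wr wi]] := (hz t, hw t); split.
  under eq_fun do rewrite reM.
  under [X in C1_at _ X]eq_fun do rewrite reD !reM.
  have := C1_at_plus (C1_at_mult zr wr) (C1_at_opp (C1_at_mult zi wi)).
  congr C1_at; apply: funext => s; rewrite /Rminus.
  ring.
under eq_fun do rewrite imM.
under [X in C1_at _ X]eq_fun do rewrite imD !imM.
have := C1_at_plus (C1_at_mult zr wi) (C1_at_mult zi wr).
congr C1_at; apply: funext => s.
ring.
Qed.

Lemma C1cV z z' : C1c z z' -> (forall t, z t != 0) ->
  C1c (fun t => (z t)^-1)
      (fun t => (invu' (re (z t)) (im (z t)) (re (z' t)) (im (z' t))
             +i* invv' (re (z t)) (im (z t)) (re (z' t)) (im (z' t)))%C).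
Proof.
move=> hz nz t; have [zr zi] := hz t; split.
  under eq_fun do rewrite reV //.
  by apply: C1_at_invu => //; apply/neq0_reim.
under eq_fun do rewrite imV //.
by apply: C1_at_invv => //; apply/neq0_reim.
Qed.

Lemma smooth_const c : smooth (fun _ => c).
Proof. exact: C1c_smooth (C1c_const c). Qed.

Lemma smoothD z w : smooth z -> smooth w -> smooth (fun t => z t + w t).
Proof. by move=> hz hw; apply: C1c_smooth (C1cD hz hw). Qed.

Lemma smoothN z : smooth z -> smooth (fun t => - z t).
Proof. by move=> hz; apply: C1c_smooth (C1cN hz). Qed.

Lemma smoothM z w : smooth z -> smooth w -> smooth (fun t => z t * w t).
Proof. by move=> hz hw; apply: C1c_smooth (C1cM hz hw). Qed.

Lemma smoothV z : smooth z -> (forall t, z t != 0) -> smooth (fun t => (z t)^-1).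
Proof. by move=> hz nz; apply: C1c_smooth (C1cV hz nz). Qed.

Definition ln_mod (z : R -> C) (t : R) : R := lnabs (re (z t)) (im (z t)).
Definition arg_form (z : R -> C) (t : R) : R :=
  darg (re (z t)) (im (z t)) (re (cderiv z t)) (im (cderiv z t)).

(** The regulator of {f, g} along the loop parametrized by [0, 2 pi]. *)
Definition reg (f g : R -> C) : R :=
  RInt (fun t => (ln_mod f t * arg_form g t - ln_mod g t * arg_form f t)%coqR) 0%coqR (2 * PI)%coqR.

(** Smooth curves in the punctured plane. *)
Definition punct (z : R -> C) : Prop := smooth z /\ forall t, z t != 0.

Lemma punctM f g : punct f -> punct g -> punct (fun t => f t * g t).
Proof.
case=> sf nf [sg ng]; split; first exact: smoothM.
by move=> t; rewrite mulf_neq0.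
Qed.

Lemma ln_mod_continuous f t : punct f -> continuous (ln_mod f) t.
Proof.
case=> sf nf; have [hr hi] := sf t.
by apply: (lnabs_continuous hr hi); apply/neq0_reim.
Qed.

Lemma arg_form_continuous f t : punct f -> continuous (arg_form f) t.
Proof.
case=> sf nf; have [hr hi] := sf t.
by apply: (darg_continuous hr hi); apply/neq0_reim.
Qed.

Lemma ln_modM f g t : f t != 0 -> g t != 0 ->
  ln_mod (fun t => f t * g t) t = (ln_mod f t + ln_mod g t)%coqR.
Proof. by move=> /neq0_reim nf /neq0_reim ng; rewrite /ln_mod reM imM lnabs_mult. Qed.

Lemma arg_formM f g t : punct f -> punct g ->
  arg_form (fun t => f t * g t) t = (arg_form f t + arg_form g t)%coqR.
Proof.
move=> [sf nf] [sg ng]; rewrite /arg_form (C1c_cderiv (C1cM sf sg)).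
rewrite !(reD, imD, reM, imM).
rewrite -[RHS]darg_mult; [|exact/neq0_reim..].
congr (darg _ _ _ _); ring.
Qed.

Lemma reg_integrand_continuous f g t : punct f -> punct g ->
  continuous (fun t => (ln_mod f t * arg_form g t - ln_mod g t * arg_form f t)%coqR) t.
Proof.
move=> pf pg; apply: continuous_minus; apply: continuous_mult;
  by [exact: ln_mod_continuous | exact: arg_form_continuous].
Qed.

Lemma reg_ex f g : punct f -> punct g ->
  ex_RInt (fun t => (ln_mod f t * arg_form g t - ln_mod g t * arg_form f t)%coqR) 0%coqR (2 * PI)%coqR.
Proof.
by move=> pf pg; apply: ex_RInt_continuous => t _; apply: reg_integrand_continuous.
Qed.

Lemma regMl f g h : punct f -> punct g -> punct h ->
  reg (fun t => f t * g t) h = (reg f h + reg g h)%coqR.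
Proof.
move=> pf pg ph.
have := RInt_plus _ _ _ _ (reg_ex pf ph) (reg_ex pg ph).
rewrite /plus /= => <-; apply: RInt_ext => t _.
rewrite ln_modM ?arg_formM //; [|exact: (proj2 pf) | exact: (proj2 pg)].
match goal with |- ?a = ?b => change (@eq R a b) end; ring.
Qed.

Lemma reg_antisym f g : punct f -> punct g -> reg f g = (- reg g f)%coqR.
Proof.
move=> pf pg; have := RInt_opp _ _ _ (reg_ex pg pf).
rewrite /opp /= => <-; apply: RInt_ext => t _; exact: (esym (Ropp_minus_distr _ _)).
Qed.

Lemma regMr f g h : punct f -> punct g -> punct h ->
  reg h (fun t => f t * g t) = (reg h f + reg h g)%coqR.
Proof.
move=> pf pg ph; rewrite reg_antisym //; last exact: punctM.
rewrite regMl // (reg_antisym pf) // (reg_antisym pg) //; ring.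
Qed.

Lemma reg_steinberg f : punct f -> punct (fun t => 1 - f t) ->
  f 0%coqR = f (2 * PI)%coqR -> reg f (fun t => 1 - f t) = 0%coqR.
Proof.
move=> [sf nf] [sg ng] per.
rewrite -(@steinberg_RInt (fun t => re (f t)) (fun t => re (cderiv f t))
  (fun t => im (f t)) (fun t => im (cderiv f t)) 0%coqR (2 * PI)%coqR); first last.
- by rewrite per.
- by rewrite per.
- move=> t; have /neq0_reim := ng t; rewrite reD imD reN imN /=.
  case=> h; [by left | right => e; apply: h].
  by rewrite e; exact: (Rplus_opp_r 0).
- by move=> t; apply/neq0_reim.
- by move=> t; have [] := sf t.
- by move=> t; have [] := sf t.
apply: RInt_ext => t _; rewrite bw_formE /ln_mod /arg_form.
have -> : cderiv (fun t => 1 - f t) = fun t => - cderiv f t.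
  rewrite (C1c_cderiv (C1cD (C1c_const 1) (C1cN sf))).
  by apply: funext => s; rewrite add0r.
rewrite !(reD, imD, reN, imN) /=.
by rewrite (Rplus_0_l (- _)).
Qed.

Local Open Scope R_scope.

Definition ln_mod_form (z : R -> C) (t : R) : R :=
  dlnabs (re (z t)) (im (z t)) (re (cderiv z t)) (im (cderiv z t)).

Lemma ln_mod_derive f t : punct f -> is_derive (ln_mod f) t (ln_mod_form f t).
Proof.
case=> sf nf; have [/C1_at_derive dr /C1_at_derive di] := sf t.
exact: (lnabs_derive dr di (proj1 (neq0_reim _) (nf t))).
Qed.

Lemma arg_form_atan f t : smooth f -> re (f t) <> 0 ->
  is_derive (fun t => atan (im (f t) / re (f t))) t (arg_form f t).
Proof.
move=> sf nr; have [/C1_at_derive dr /C1_at_derive di] := sf t.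
exact: (atan_derive dr di nr).
Qed.

Definition loop (f : R -> C) : Prop := f 0 = f (2 * PI).

(** A loop in a half-plane does not wind around 0: atan(im / re) is a primitive. *)
Lemma RInt_arg_form0 f : punct f -> loop f -> (forall t, re (f t) <> 0) ->
  RInt (arg_form f) 0 (2 * PI) = 0.
Proof.
move=> pf cf nr.
apply: (@RInt_derive_closed (fun t => atan (im (f t) / re (f t)))) => [t|t|].
- by apply: arg_form_atan => //; case: pf.
- exact: arg_form_continuous.
- by rewrite cf.
Qed.

Lemma RInt_bound (F : R -> R) M : (forall t, continuous F t) ->
  (forall t, Rabs (F t) <= M) -> Rabs (RInt F 0 (2 * PI)) <= 2 * PI * M.
Proof.
move=> cF bF; have := abs_RInt_le_const F 0 (2 * PI) M.
rewrite Rminus_0_r; apply; first by have := PI_RGT_0; lra.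
  by apply: ex_RInt_continuous => t _.
by move=> t _.
Qed.

Lemma reg_const f c : punct f ->
  reg f (fun _ => c) = - (lnabs (re c) (im c) * RInt (arg_form f) 0 (2 * PI)).
Proof.
move=> pf; have ex : ex_RInt (arg_form f) 0 (2 * PI).
  by apply: ex_RInt_continuous => t _; apply: arg_form_continuous.
have := RInt_scal _ _ _ (- lnabs (re c) (im c)) ex.
rewrite /scal /= /mult /= Ropp_mult_distr_l => <-; apply: RInt_ext => t _.
rewrite /arg_form (C1c_cderiv (C1c_const c)) /darg /ln_mod /=.
match goal with |- ?a = ?b => change (@eq R a b) end.
rewrite /Rdiv (_ : re c * 0 - im c * 0 = 0); last ring.
ring.
Qed.

Lemma ln_mod_form_continuous f t : punct f -> continuous (ln_mod_form f) t.
Proof.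
case=> sf nf; have [hr hi] := sf t; have n0 := abs2_gt0 (proj1 (neq0_reim _) (nf t)).
have [[cr ci] [[_ cr'] [_ ci']]] := ((C1_at_continuous hr, C1_at_continuous hi), (hr, hi)).
apply: continuous_mult; first by apply: continuous_plus; apply: continuous_mult.
apply: continuous_Rinv_comp; first by apply: continuous_plus; apply: continuous_mult.
lra.
Qed.

Lemma Rabs_mult_le a b A B : Rabs a <= A -> Rabs b <= B -> Rabs (a * b) <= A * B.
Proof. by move=> ha hb; rewrite Rabs_mult; apply: Rmult_le_compat => //; apply: Rabs_pos. Qed.

(** Integrate ln|f| d arg g by parts, with the bounded primitive atan(im g / re g) of
d arg g. The bound does not involve the derivative of [g]. *)
Lemma reg_half_plane f g L D : punct f -> punct g -> loop f -> loop g ->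
  (forall t, 0 < re (g t)) ->
  (forall t, Rabs (ln_mod f t) <= L) -> (forall t, Rabs (ln_mod g t) <= L) ->
  (forall t, Rabs (ln_mod_form f t) <= D) -> (forall t, Rabs (arg_form f t) <= D) ->
  Rabs (reg f g) <= 2 * PI * (2 * D + L * D).
Proof.
move=> pf pg cf cg rg lf lg df af.
pose th t := atan (im (g t) / re (g t)).
have nr t : re (g t) <> 0 by have := rg t; lra.
have dth t : is_derive th t (arg_form g t) by apply: arg_form_atan => //; case: pg.
have cth t : continuous th t by apply: ex_derive_continuous; exists (arg_form g t).
have cont1 t : continuous (fun t => ln_mod_form f t * th t + ln_mod f t * arg_form g t) t.
  apply: continuous_plus; apply: continuous_mult => //.
  - exact: ln_mod_form_continuous.
  - exact: ln_mod_continuous.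
  - exact: arg_form_continuous.
have cont2 t : continuous (fun t => - (ln_mod_form f t * th t) - ln_mod g t * arg_form f t) t.
  apply: continuous_minus; last first.
    by apply: continuous_mult; [exact: ln_mod_continuous | exact: arg_form_continuous].
  apply: (continuous_opp (V := R_NormedModule)).
  by apply: continuous_mult => //; apply: ln_mod_form_continuous.
have zero : RInt (fun t => ln_mod_form f t * th t + ln_mod f t * arg_form g t) 0 (2 * PI) = 0.
  apply: (@RInt_derive_closed (fun t => ln_mod f t * th t)) => // [t|].
    exact: (is_derive_mult _ _ _ _ _ (ln_mod_derive t pf) (dth t) Rmult_comm).
  by rewrite /th /ln_mod cf cg.
have -> : reg f g = RInt (fun t => - (ln_mod_form f t * th t) - ln_mod g t * arg_form f t) 0 (2 * PI).
  rewrite -[RHS]Rplus_0_r -{2}zero.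
  rewrite -[RHS](RInt_plus (V := R_CompleteNormedModule)); last 2 first.
  - by apply: ex_RInt_continuous.
  - by apply: ex_RInt_continuous.
  apply: RInt_ext => t _; rewrite /plus /=.
  match goal with |- ?a = ?b => change (@eq R a b) end; ring.
apply: RInt_bound => // t.
have thb : Rabs (th t) <= 2.
  have [h1 h2] := atan_bound (im (g t) / re (g t)); have := PI_4 => h4.
  by apply: Rabs_le; rewrite /th; lra.
have /Rabs_le_between h1 := Rabs_mult_le (df t) thb.
have /Rabs_le_between h2 := Rabs_mult_le (lg t) (af t).
by apply: Rabs_le; lra.
Qed.

Lemma reg_bounded f g L D : punct f -> punct g ->
  (forall t, Rabs (ln_mod f t) <= L) -> (forall t, Rabs (ln_mod g t) <= L) ->
  (forall t, Rabs (arg_form f t) <= D) -> (forall t, Rabs (arg_form g t) <= D) ->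
  Rabs (reg f g) <= 2 * PI * (2 * (L * D)).
Proof.
move=> pf pg lf lg af ag; apply: RInt_bound => t.
  exact: reg_integrand_continuous.
have /Rabs_le_between h1 := Rabs_mult_le (lf t) (ag t).
have /Rabs_le_between h2 := Rabs_mult_le (lg t) (af t).
by apply: Rabs_le; lra.
Qed.

Lemma ln_mod_bound (z : R -> C) t :
  / 16 <= re (z t) * re (z t) + im (z t) * im (z t) <= 16 -> Rabs (ln_mod z t) <= ln 4.
Proof.
move=> [h1 h2]; rewrite /ln_mod /lnabs.
have n0 : 0 < re (z t) * re (z t) + im (z t) * im (z t) by lra.
have e : ln 16 = 2 * ln 4 by rewrite (_ : 16 = 4 * 4) ?ln_mult; lra.
have l1 : ln (re (z t) * re (z t) + im (z t) * im (z t)) <= ln 16 by apply: ln_le.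
have l2 : - ln 16 <= ln (re (z t) * re (z t) + im (z t) * im (z t)).
  by rewrite -ln_Rinv; [apply: ln_le; lra | lra].
by apply: Rabs_le; lra.
Qed.

(** The curve x - b above the circle |x - a| = r is [circle (a - b) r]. *)
Definition circle (a r : R) (t : R) : C := ((a + r * cos t)%coqR +i* (r * sin t)%coqR)%C.

Lemma circle_C1c a r : C1c (circle a r) (fun t => ((- (r * sin t))%coqR +i* (r * cos t)%coqR)%C).
Proof.
move=> t; split; rewrite /circle /=.
  have := C1_at_plus (C1_at_const a t) (C1_at_mult (C1_at_const r t) (C1_at_cos t)).
  by congr C1_at; apply: funext => s; ring.
have := C1_at_mult (C1_at_const r t) (C1_at_sin t).
by congr C1_at; apply: funext => s; ring.
Qed.

Lemma circle_loop a r : loop (circle a r).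
Proof. by rewrite /loop /circle cos_0 sin_0 cos_2PI sin_2PI. Qed.

(** * Asymptotics of the regulator on small circles *)

(** The distances between the points 0, 1, -1 are 0, 1 and 2, so that on a circle of
radius between 1/4 and 1/2 around one of them all the functions x - b have modulus
between 1/4 and 4. *)
Section Circle.
Variables (d r : R).
Hypotheses (hr : / 4 < r < / 2) (hd : d = 0 \/ 1 <= Rabs d <= 2).

Let norm2 t := (d + r * cos t) * (d + r * cos t) + (r * sin t) * (r * sin t).

Let norm2E t : norm2 t = d * d + 2 * d * (r * cos t) + r * r.
Proof.
have := sin2_cos2 t; rewrite /Rsqr /norm2 => h.
have -> : (d + r * cos t) * (d + r * cos t) + r * sin t * (r * sin t)
  = d * d + 2 * d * (r * cos t) + r * r * (sin t * sin t + cos t * cos t) by ring.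
by rewrite h; ring.
Qed.

Let rcos t : - r <= r * cos t <= r.
Proof. by have [h1 h2] := COS_bound t; nra. Qed.

Lemma circle_norm2 t : / 16 <= norm2 t <= 16.
Proof.
rewrite norm2E; have h := rcos t; case: hd => [->|]; first nra.
by rewrite /Rabs; case: Rcase_abs => d0 d1; nra.
Qed.

Lemma circle_neq0 t : circle d r t != 0%R.
Proof.
apply/neq0_reim; have := circle_norm2 t; rewrite /norm2 /circle /= => h.
have [e|] := Req_dec (d + r * cos t) 0; last by left.
right=> e'; rewrite e e' in h; lra.
Qed.

Lemma circle_punct : punct (circle d r).
Proof. by split; [exact: C1c_smooth (circle_C1c _ _) | exact: circle_neq0]. Qed.

Lemma circle_ln_mod t : Rabs (ln_mod (circle d r) t) <= ln 4.
Proof. exact: (@ln_mod_bound (circle d r) t (circle_norm2 t)). Qed.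

Let quot_le2 u v u' v' : / 16 <= u * u + v * v -> u' * u' + v' * v' <= / 4 ->
  Rabs ((u * u' + v * v') / (u * u + v * v)) <= 2.
Proof.
move=> hn h'; have n0 : 0 < u * u + v * v by lra.
have cs : (u * u' + v * v') * (u * u' + v * v') <= (u * u + v * v) * / 4.
  apply: (Rle_trans _ ((u * u + v * v) * (u' * u' + v' * v'))); last nra.
  have := Rle_0_sqr (u * v' - v * u'); rewrite /Rsqr; lra.
have h : Rabs (u * u' + v * v') <= 2 * (u * u + v * v).
  by apply: Rabs_le; split; nra.
rewrite Rabs_div; last lra.
rewrite (Rabs_right (u * u + v * v)); last lra.
by apply/Rle_div_l; lra.
Qed.

Let speed t : (- (r * sin t)) * (- (r * sin t)) + (r * cos t) * (r * cos t) <= / 4.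
Proof.
have := sin2_cos2 t; rewrite /Rsqr => h.
have -> : (- (r * sin t)) * (- (r * sin t)) + (r * cos t) * (r * cos t)
  = r * r * (sin t * sin t + cos t * cos t) by ring.
by rewrite h; nra.
Qed.

Lemma circle_ln_mod_form t : Rabs (ln_mod_form (circle d r) t) <= 2.
Proof.
rewrite /ln_mod_form (C1c_cderiv (circle_C1c d r)) /= /dlnabs.
by apply: quot_le2; [have := circle_norm2 t; rewrite /norm2; lra | exact: speed].
Qed.

Lemma circle_arg_form t : Rabs (arg_form (circle d r) t) <= 2.
Proof.
rewrite /arg_form (C1c_cderiv (circle_C1c d r)) /= /darg.
have := @quot_le2 (d + r * cos t) (r * sin t) (r * cos t) (- (- (r * sin t))).
have -> : (d + r * cos t) * (r * cos t) + r * sin t * - - (r * sin t)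
  = (d + r * cos t) * (r * cos t) - r * sin t * - (r * sin t) by ring.
apply; first by have := circle_norm2 t; rewrite /norm2; lra.
have := speed t; lra.
Qed.

Lemma RInt_arg_form_circle :
  RInt (arg_form (circle d r)) 0 (2 * PI) = if Req_dec_T d 0 then 2 * PI else 0.
Proof.
case: Req_dec_T => d0.
  rewrite (RInt_ext _ (fun _ => 1)).
    by rewrite RInt_const /scal /= /mult /=; ring.
  move=> t _; rewrite /arg_form (C1c_cderiv (circle_C1c d r)) /= /darg d0.
  have := sin2_cos2 t; rewrite /Rsqr => h.
  have -> : (0 + r * cos t) * (0 + r * cos t) + r * sin t * (r * sin t)
    = r * r * (sin t * sin t + cos t * cos t) by ring.
  rewrite h.
  have -> : (0 + r * cos t) * (r * cos t) - r * sin t * - (r * sin t)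
    = r * r * (sin t * sin t + cos t * cos t) by ring.
  by rewrite h; field; lra.
apply: RInt_arg_form0; [exact: circle_punct | exact: circle_loop | ].
move=> t; rewrite /circle /=; have h := rcos t; case: hd => // -[].
by rewrite /Rabs; case: Rcase_abs => ? ? _; lra.
Qed.

End Circle.

(** Five factors x - b' contribute at most 2 (ln 4) 2 each, and G at most
2 . 2 + (ln 4) 2, per unit of length. *)
Definition reg_error : R := 2 * PI * (5 * (2 * (ln 4 * 2)) + (2 * 2 + ln 4 * 2)).

Lemma punct_const c : c != 0%R -> punct (fun _ => c).
Proof. by move=> nc; split; [exact: smooth_const | move=> _]. Qed.

Lemma ln4_pos : 0 < ln 4.
Proof. by rewrite -ln_1; apply: ln_increasing; lra. Qed.

Section Asymptotics.
Variables (a b r : R) (s : seq R).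
Hypotheses (hr : / 4 < r < / 2) (hb : a - b = 0 \/ 1 <= Rabs (a - b) <= 2).
Hypothesis hs : forall b', b' \in s -> a - b' = 0 \/ 1 <= Rabs (a - b') <= 2.

Let prodc (s : seq R) (t : R) : C := (\prod_(b' <- s) circle (a - b') r t)%R.

Lemma prod_circlele_reg :
  punct (prodc s) /\ Rabs (reg (circle (a - b) r) (prodc s))
    <= INR (size s) * (2 * PI * (2 * (ln 4 * 2))).
Proof.
elim: s hs => [|c s' IH] h.
  have -> : prodc [::] = fun _ => 1%R by apply: funext => t; rewrite /prodc big_nil.
  split; first by apply: punct_const; rewrite oner_neq0.
  rewrite reg_const; last exact: circle_punct.
  rewrite /lnabs /= (_ : 1%R * 1%R + 0%R * 0%R = 1); last by rewrite Rmult_0_l Rplus_0_r Rmult_1_l.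
  by rewrite ln_1 Rmult_0_r !Rmult_0_l Ropp_0 Rabs_R0; lra.
have -> : prodc (c :: s') = fun t => (circle (a - c) r t * prodc s' t)%R.
  by apply: funext => t; rewrite /prodc big_cons.
have hc := h c (mem_head _ _).
have [p1 b1] := IH (fun b' hb' => h b' (mem_behead (s := c :: s') hb')).
have pc := circle_punct hr hc; have pb := circle_punct hr hb.
split; first exact: punctM.
rewrite regMr // [size _]/= S_INR.
have b2 := reg_bounded pb pc (circle_ln_mod hr hb) (circle_ln_mod hr hc) (circle_arg_form hr hb) (circle_arg_form hr hc).
apply: Rle_trans (Rabs_triang _ _) _; lra.
Qed.

(** The constant c contributes - ln|c| times the winding number of x - b, and the other
factors a bounded amount. *)
Lemma reg_asymptotics (c : C) (G : R -> C) : leq (size s) 5 ->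
  c != 0%R -> punct G -> loop G -> (forall t, 0 < re (G t)) ->
  (forall t, / 16 <= re (G t) * re (G t) + im (G t) * im (G t) <= 16) ->
  Rabs (reg (circle (a - b) r) (fun t => c * (prodc s t * G t))%R
        + lnabs (re c) (im c) * (if Req_dec_T (a - b) 0 then 2 * PI else 0)) <= reg_error.
Proof.
move=> s5 nc pG cG rG bG; have [pp bp] := prod_circlele_reg.
have pb := circle_punct hr hb.
rewrite regMr //; [|exact: punct_const|exact: punctM].
rewrite regMr // reg_const // RInt_arg_form_circle //.
have := @reg_half_plane (circle (a - b) r) G (ln 4) 2 pb pG (circle_loop _ _) cG rG
  (circle_ln_mod hr hb) (fun t => ln_mod_bound (bG t)) (circle_ln_mod_form hr hb) (circle_arg_form hr hb).
have : INR (size s) <= 5.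
  by rewrite (_ : 5 = INR 5); [apply: le_INR; apply/ssrnat.leP | rewrite /=; ring].
have := ln4_pos; have := PI_RGT_0 => pi0 l0 s5'.
have : INR (size s) * (2 * PI * (2 * (ln 4 * 2))) <= 5 * (2 * PI * (2 * (ln 4 * 2))).
  by apply: Rmult_le_compat_r => //; nra.
move: bp => /Rabs_le_between bp b5 /Rabs_le_between b6.
by apply: Rabs_le; rewrite /reg_error; lra.
Qed.

End Asymptotics.

(** The square root with positive real part of a number with positive real part: if
p^2 = (|z| + re z) / 2, it is p + i im z / (2 p). *)
Definition csqrt (z : C) : C :=
  let p := sqrt ((sqrt (re z * re z + im z * im z) + re z) / 2) in
  (p +i* (im z / (2 * p))%coqR)%C.

Lemma csqrt_re_gt0 z : 0 < re z -> 0 < re (csqrt z).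
Proof.
move=> h; rewrite /csqrt /=; apply: sqrt_lt_R0.
by have := sqrt_pos (re z * re z + im z * im z); lra.
Qed.

Lemma csqrtK z : 0 < re z -> (csqrt z * csqrt z)%R = z.
Proof.
move=> h; have p0 := csqrt_re_gt0 h; move: p0; rewrite /csqrt /=.
set m := sqrt (re z * re z + im z * im z).
have mm : m * m = re z * re z + im z * im z by rewrite sqrt_def //; nra.
have m0 : 0 <= m by apply: sqrt_pos.
set p := sqrt ((m + re z) / 2) => p0.
have pp : p * p = (m + re z) / 2 by rewrite sqrt_def //; lra.
have e1 : p * p - im z / (2 * p) * (im z / (2 * p)) = re z.
  have -> : im z / (2 * p) * (im z / (2 * p)) = im z * im z / (4 * (p * p)) by field; lra.
  rewrite pp (_ : im z * im z = m * m - re z * re z); last by lra.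
  by field; lra.
have e2 : p * (im z / (2 * p)) + im z / (2 * p) * p = im z by field; lra.
move: e1 e2; case: z h m mm m0 p p0 pp => x y /= _ m mm m0 p p0 pp e1 e2.
by apply/eqP; rewrite eq_complex /=; apply/andP; split; apply/eqP.
Qed.

Lemma csqrt_smooth z : smooth z -> (forall t, 0 < re (z t)) -> smooth (fun t => csqrt (z t)).
Proof.
move=> sz rz.
have n0 t : 0 < re (z t) * re (z t) + im (z t) * im (z t) by have := rz t; nra.
have m0 t : 0 < (sqrt (re (z t) * re (z t) + im (z t) * im (z t)) + re (z t)) / 2.
  by have := rz t; have := sqrt_pos (re (z t) * re (z t) + im (z t) * im (z t)); lra.
have [zr zi] : (forall t, C1_at (fun t => re (z t)) (fun t => re (cderiv z t)) t) /\
  (forall t, C1_at (fun t => im (z t)) (fun t => im (cderiv z t)) t).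
  by split=> t; have [] := sz t.
have cn t := C1_at_plus (C1_at_mult (zr t) (zr t)) (C1_at_mult (zi t) (zi t)).
have cm t := C1_at_mult (C1_at_plus (C1_at_sqrt (cn t) (n0 t)) (zr t)) (C1_at_const (/ 2) t).
have cp t := C1_at_sqrt (cm t) (m0 t).
have p0 t : 2 * sqrt ((sqrt (re (z t) * re (z t) + im (z t) * im (z t)) + re (z t)) * / 2) <> 0.
  by have := sqrt_lt_R0 _ (m0 t); rewrite /Rdiv; lra.
have ci t := C1_at_mult (zi t) (C1_at_Rinv (C1_at_mult (C1_at_const 2 t) (cp t)) (p0 t)).
move=> t; split; [exact: (C1_at_eq (cp t)) | exact: (C1_at_eq (ci t))].
Qed.

Lemma re1 : re (1%R : C) = 1. Proof. by []. Qed.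
Lemma re_real (x : R) : re (x%:C)%C = x. Proof. by []. Qed.
Lemma im_real (x : R) : im (x%:C)%C = 0. Proof. by []. Qed.

(** * The branch of y for large k *)

Definition cabs (z : C) : R := sqrt (re z * re z + im z * im z).

Lemma cabs_ge0 (z : C) : 0 <= cabs z. Proof. exact: sqrt_pos. Qed.

Lemma cabs_sq (z : C) : cabs z * cabs z = re z * re z + im z * im z.
Proof. by rewrite sqrt_def //; nra. Qed.

Lemma cabs_gt0 (z : C) : z != 0%R -> 0 < cabs z.
Proof. by move=> /neq0_reim/abs2_gt0 h; apply: sqrt_lt_R0. Qed.

Lemma cabsM (z w : C) : cabs (z * w)%R = cabs z * cabs w.
Proof.
rewrite /cabs reM imM -sqrt_mult_alt; last nra.
by congr sqrt; ring.
Qed.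

Lemma cabsD (z w : C) : cabs (z + w)%R <= cabs z + cabs w.
Proof.
have [z0 w0] := (cabs_ge0 z, cabs_ge0 w).
apply: Rsqr_incr_0_var; last lra.
have e := cabs_sq (z + w)%R; rewrite /Rsqr e reD imD.
have [ez ew] := (cabs_sq z, cabs_sq w).
have h : re z * re w + im z * im w <= cabs z * cabs w.
  apply: Rsqr_incr_0_var; last exact: Rmult_le_pos.
  rewrite /Rsqr; have -> : cabs z * cabs w * (cabs z * cabs w)
    = (cabs z * cabs z) * (cabs w * cabs w) by ring.
  rewrite ez ew; have := Rle_0_sqr (re z * im w - im z * re w); rewrite /Rsqr; lra.
lra.
Qed.

Lemma cabsN (z : C) : cabs (- z)%R = cabs z.
Proof. by rewrite /cabs reN imN; congr sqrt; ring. Qed.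

Lemma cabs_re (z : C) : - cabs z <= re z <= cabs z.
Proof.
apply/Rabs_le_between; rewrite -(sqrt_Rsqr_abs (re z)).
by apply: sqrt_le_1_alt; rewrite /Rsqr; nra.
Qed.

Lemma cabs1 : cabs 1%R = 1.
Proof.
by rewrite /cabs /= Rmult_0_l Rplus_0_r Rmult_1_l sqrt_1.
Qed.

Lemma cabsV (z : C) : z != 0%R -> cabs (z^-1)%R = / cabs z.
Proof.
move=> nz; have z0 := cabs_gt0 nz.
apply: (Rmult_eq_reg_l (cabs z)); last lra.
by rewrite -cabsM mulfV // cabs1 Rinv_r; lra.
Qed.

Lemma cabsX (z : C) n : cabs (z ^+ n)%R = cabs z ^ n.
Proof. by elim: n => [|n IH]; rewrite ?expr0 ?cabs1 // exprS cabsM IH. Qed.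

Lemma lnabs_cabs (z : C) : z != 0%R -> lnabs (re z) (im z) = ln (cabs z).
Proof.
move=> nz; have z0 := cabs_gt0 nz; rewrite /lnabs -cabs_sq ln_mult //.
by rewrite -[ln (cabs z) + _](_ : 2 * ln (cabs z) = _); [field | ring].
Qed.

Lemma cabs_norm (z : C) : `|z|%R = ((cabs z)%:C)%C.
Proof. by rewrite normc_def /cabs RsqrtE ?expr2 //; apply/RleP; nra. Qed.

(** The discriminant 1 + dlt is within 5/8 of 1, so its square root S is defined with
positive real part, and the root (1 + e + S) / 2 has real part at least 3/8. *)
Lemma csqrt_branch (e eps : R -> C) : smooth e -> smooth eps -> loop e -> loop eps ->
  (forall t, cabs (e t) <= / 4) -> (forall t, cabs (eps t) <= / 64) ->
  exists G : R -> C, [/\ punct G, loop G, forall t, 0 < re (G t),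
    forall t, / 16 <= re (G t) * re (G t) + im (G t) * im (G t) <= 16 &
    forall t, (G t * G t - (1 + e t) * G t + eps t)%R = 0%R].
Proof.
move=> se seps ce ceps be beps.
pose dlt t : C := (e t + e t + e t * e t - (eps t + eps t + eps t + eps t))%R.
have sd : smooth dlt.
  by rewrite /dlt; repeat first [assumption | apply: smoothD | apply: smoothN | apply: smoothM].
have bd t : cabs (dlt t) <= 5 / 8.
  have h1 := cabsD (e t + e t + e t * e t)%R (- (eps t + eps t + eps t + eps t))%R.
  have h2 := cabsD (e t + e t)%R (e t * e t)%R; have h3 := cabsD (e t) (e t).
  have h4 := cabsD (eps t + eps t + eps t)%R (eps t).
  have h5 := cabsD (eps t + eps t)%R (eps t); have h6 := cabsD (eps t) (eps t).
  rewrite cabsN in h1; rewrite cabsM in h2.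
  have := be t; have := beps t; have := cabs_ge0 (e t) => e0 b1 b2.
  rewrite /dlt; nra.
pose S (t : R) : C := csqrt (1 + dlt t)%R.
have rd t : 0 < re (1 + dlt t)%R.
  by rewrite reD re1; have := cabs_re (dlt t); have := bd t; lra.
have sS : smooth S by apply: csqrt_smooth => //; apply: smoothD => //; apply: smooth_const.
have SS t : (S t * S t)%R = (1 + dlt t)%R by apply: csqrtK.
have rS t : 0 < re (S t) by apply: csqrt_re_gt0.
have bS t : cabs (S t) <= 2.
  have := cabsD 1%R (dlt t); rewrite -SS cabsM cabs1; have := bd t; have := cabs_ge0 (S t).
  nra.
pose G (t : R) : C := (((/ 2)%:C)%C * (1 + e t + S t))%R.
have rG t : 3 / 8 <= re (G t).
  rewrite reM !reD re1 re_real im_real.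
  have := cabs_re (e t); have := be t; have := rS t; lra.
have aG t : cabs (G t) <= 4.
  have h1 : cabs (1 + e t + S t)%R <= cabs (1 + e t)%R + cabs (S t) by exact: cabsD.
  have h2 : cabs (1 + e t)%R <= 1 + cabs (e t) by rewrite -cabs1; exact: cabsD.
  rewrite cabsM (_ : cabs ((/ 2)%:C)%C = / 2); first by have := be t; have := bS t; lra.
  by rewrite /cabs re_real im_real Rmult_0_l Rplus_0_r; apply: sqrt_square; lra.
exists G; split.
- split.
    apply: smoothM; first exact: smooth_const.
    by apply: smoothD => //; apply: smoothD => //; apply: smooth_const.
  by move=> t; apply/neq0_reim; left => h; have := rG t; rewrite h; lra.
- by rewrite /loop /G /S /dlt ce ceps.
- by move=> t; have := rG t; lra.
- move=> t; have := cabs_sq (G t) => <-; have a4 := aG t.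
  have a0 : 3 / 8 <= cabs (G t) by have := cabs_re (G t); have := rG t; lra.
  by split; nra.
move=> t.
apply: (@quadratic_formula C ((/ 2)%:C)%C (e t) (S t) (eps t)); last exact: SS.
have -> : (2 : C)%R = ((2%:R : R)%:C)%C by rewrite rmorph_nat.
rewrite -rmorphM /= (_ : (/ 2 * 2%:R)%R = 1%R) //.
by change (@eq R (/ 2 * (1 + 1)) 1); field.
Qed.

Lemma fam_pts_real fam : fam_pts C fam = [seq ((b : R)%:C)%C | b <- fam_pts R fam].
Proof. by case: fam => [s||s]; rewrite /= !(rmorph0, rmorph1, rmorphN1). Qed.

Lemma circle_shift a b r t : (circle a r t - (b%:C)%C)%R = circle (a - b) r t.
Proof.
apply/eqP; rewrite eq_complex; apply/andP; split; apply/eqP.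
  by rewrite reD reN re_real /circle /=; ring.
by rewrite imD imN im_real /circle /=; ring.
Qed.

Lemma fam_prod a r t fam : (\prod_(b <- fam_pts C fam) (circle a r t - b))%R
  = (\prod_(b <- fam_pts R fam) circle (a - b) r t)%R.
Proof. by rewrite fam_pts_real big_map; apply: eq_bigr => b _; rewrite circle_shift. Qed.

Lemma prod_circlele_ge a r (s : seq R) t : / 4 < r < / 2 ->
  (forall b, b \in s -> a - b = 0 \/ 1 <= Rabs (a - b) <= 2) ->
  (/ 4) ^ size s <= cabs (\prod_(b <- s) circle (a - b) r t)%R.
Proof.
move=> hr; elim: s => [|b s IH] hs; first by rewrite big_nil cabs1 /=; lra.
rewrite big_cons cabsM [size _]/=.
have hb := hs b (mem_head _ _).
have := IH (fun b' hb' => hs b' (mem_behead (s := b :: s) hb')).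
apply: Rmult_le_compat; first lra; first by apply: pow_le; lra.
have := cabs_sq (circle (a - b) r t); have := circle_norm2 hr hb t => -[h _].
have := cabs_ge0 (circle (a - b) r t); rewrite /= in h * => h0 h1; nra.
Qed.

Lemma smooth_horner (p : {poly C}) (z : R -> C) : smooth z -> smooth (fun t => p.[z t])%R.
Proof.
move=> sz; elim/poly_ind: p => [|p c IH].
  have -> : (fun t => (0 : {poly C}).[z t])%R = fun _ => 0%R.
    by apply: funext => t; rewrite horner0.
  exact: smooth_const.
have -> : (fun t => (p * 'X + c%:P).[z t])%R = (fun t => p.[z t] * z t + c)%R.
  by apply: funext => t; rewrite hornerMXaddC.
exact: smoothD (smoothM IH sz) (smooth_const c).
Qed.

Lemma fam_h_smooth fam (z : R -> C) : smooth z -> smooth (fun t => fam_h fam (z t)).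
Proof.
move=> sz; have -> : (fun t => fam_h fam (z t)) = (fun t => (family_f (0 : C) fam).[z t])%R.
  by apply: funext => t; rewrite family_fE mul0r add0r.
exact: smooth_horner.
Qed.

Lemma cabs_sign (s : bool) : cabs ((-1) ^+ s)%R = 1.
Proof. by rewrite cabsX cabsN cabs1 pow1. Qed.

Lemma cabs_le_add (z w : C) (A B : R) : cabs z <= A -> cabs w <= B -> cabs (z + w)%R <= A + B.
Proof. by move=> hz hw; have := cabsD z w; lra. Qed.

Lemma cabs_le_opp (z : C) (A : R) : cabs z <= A -> cabs (- z)%R <= A.
Proof. by rewrite cabsN. Qed.

Lemma cabs_le_mul (z w : C) (A B : R) : cabs z <= A -> cabs w <= B -> cabs (z * w)%R <= A * B.
Proof. by move=> hz hw; rewrite cabsM; apply: Rmult_le_compat => //; apply: cabs_ge0. Qed.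

Lemma cabs_le_exp (z : C) (A : R) n : cabs z <= A -> cabs (z ^+ n)%R <= A ^ n.
Proof. by move=> h; rewrite cabsX; apply: pow_incr; split=> //; apply: cabs_ge0. Qed.

Lemma fam_h_bound fam (z : C) : cabs z <= 4 -> cabs (fam_h fam z) <= 5000.
Proof.
move=> hz; have p n := cabs_le_exp n hz.
have c1 : cabs (1%R : C) <= 1 by rewrite cabs1; lra.
have cs (s : bool) : cabs ((-1) ^+ s)%R <= 1 by rewrite cabs_sign; lra.
case: fam => [s||s].
- have := cabs_le_add (cabs_le_add (p 5%nat) c1)
    (cabs_le_mul (cabs_le_add (cabs_le_opp c1) (cs s)) (cabs_le_add (p 3%nat) (p 2%nat))).
  by move=> h; apply: Rle_trans h _; lra.
- have := cabs_le_add (cabs_le_add (cabs_le_add (p 6%nat) c1)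
    (cabs_le_opp (cabs_le_add (p 4%nat) (p 2%nat)))) (cabs_le_add (p 3%nat) (p 3%nat)).
  by move=> h; apply: Rle_trans h _; lra.
- have := cabs_le_add (cabs_le_add (p 6%nat) c1)
    (cabs_le_opp (cabs_le_mul (cabs_le_add c1 (cs s)) (cabs_le_add (p 4%nat) (p 2%nat)))).
  by move=> h; apply: Rle_trans h _; lra.
Qed.

Definition center (a : R) : Prop := a = 0 \/ a = 1 \/ a = -1.

Lemma fam_pts_center fam b : b \in fam_pts R fam -> center b.
Proof.
by case: fam => [s||s]; rewrite !inE; repeat (case/orP); move/eqP=> ->;
  first [by left | by right; left | by right; right].
Qed.

Lemma center_sub a b : center a -> center b -> a - b = 0 \/ 1 <= Rabs (a - b) <= 2.
Proof.
by move=> [->|[->|->]] [->|[->|->]]; rewrite /Rabs; case: Rcase_abs => ?;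
  first [by left; lra | by right; lra].
Qed.

(** Here |q| >= 4^(-5) = 1/1024, |h| and |g| are at most 5000, and
20480000 = 4 . 1024 . 5000 makes |h / (k q)| at most 1/4. *)
Lemma branch_exists fam (k : C) (a r : R) : / 4 < r < / 2 -> center a ->
  20480000 < cabs k ->
  exists G : R -> C, [/\ punct G, loop G, forall t, 0 < re (G t),
    forall t, / 16 <= re (G t) * re (G t) + im (G t) * im (G t) <= 16 &
    forall t, let Y := (- k * ((\prod_(b <- fam_pts R fam) circle (a - b) r t) * G t))%R in
      (Y ^+ 2 + (family_f k fam).[circle a r t] * Y + (family_g C fam).[circle a r t])%R = 0%R].
Proof.
move=> hr ca hk.
have hs b : b \in fam_pts R fam -> a - b = 0 \/ 1 <= Rabs (a - b) <= 2.
  by move=> /fam_pts_center; apply: center_sub.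
pose q t : C := (\prod_(b <- fam_pts R fam) circle (a - b) r t)%R.
have [sq nq] : punct q.
  by have [] := prod_circlele_reg (b := a) hr (or_introl (Rminus_diag_eq a a erefl)) hs.
have nk : k != 0%R.
  by apply/eqP => k0; move: hk; rewrite k0 /cabs /= !Rmult_0_l Rplus_0_r sqrt_0; lra.
have bq t : / 1024 <= cabs (q t).
  apply: Rle_trans (prod_circlele_ge t hr hs); case: (fam) => [s||s] /=; lra.
have lX := circle_loop a r.
have lq : loop q by rewrite /loop /q; apply: eq_bigr => b _; exact: circle_loop.
have sX : smooth (circle a r) := C1c_smooth (circle_C1c a r).
have bX t : cabs (circle a r t) <= 4.
  have h0 : a = 0 \/ 1 <= Rabs a <= 2 by have := center_sub ca (or_introl erefl); rewrite Rminus_0_r.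
  have [_] := circle_norm2 hr h0 t; have := cabs_sq (circle a r t); have := cabs_ge0 (circle a r t).
  by rewrite /circle /= => h1 h2 h3; nra.
have nkq t : (k * q t)%R != 0%R by rewrite mulf_neq0.
have skq : smooth (fun t => k * q t)%R by apply: smoothM => //; apply: smooth_const.
have bkq t : 20000 <= cabs (k * q t)%R by rewrite cabsM; have := bq t; nra.
have sg : smooth (fun t => (family_g C fam).[circle a r t])%R by apply: smooth_horner.
have bg t : cabs ((family_g C fam).[circle a r t])%R <= 5000.
  have := cabs_le_exp 5 (bX t); have := cabs_le_exp 6 (bX t).
  by case: (fam) => [s||s]; rewrite /family_g hornerXn => h6 h5;
    first [apply: (Rle_trans _ _ _ h5); lra | apply: (Rle_trans _ _ _ h6); lra].
have inv_le t : 0 < cabs (k * q t)%R by have := bkq t; lra.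
have [G [pG lG rG bG eG]] := @csqrt_branch
  (fun t => fam_h fam (circle a r t) / (k * q t))%R
  (fun t => (family_g C fam).[circle a r t] / (k * q t * (k * q t)))%R
  (smoothM (fam_h_smooth fam sX) (smoothV skq nkq))
  (smoothM sg (smoothV (smoothM skq skq) (fun t => mulf_neq0 (nkq t) (nkq t))))
  (ltac:(by rewrite /loop lX lq)) (ltac:(by rewrite /loop lX lq))
  (ltac:(move=> t; rewrite cabsM cabsV //; apply/Rle_div_l => //;
         have := fam_h_bound fam (bX t); have := bkq t; lra))
  (ltac:(move=> t; rewrite cabsM cabsV ?mulf_neq0 //; apply/Rle_div_l; rewrite cabsM;
         have := bg t; have := bkq t; nra)).
exists G; split=> // t Y; rewrite family_fE fam_prod -/(q t).
exact: branch_equation nk (nq t) (eG t).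
Qed.

Local Close Scope R_scope.

(** * Functions on the curve as loops *)

(** For all radii in (1/4, 1/2) outside a finite set. *)
Definition mostly (P : R -> Prop) : Prop :=
  exists l : seq R, forall r, (/ 4 < r < / 2)%coqR -> r \notin l -> P r.

Lemma mostly_all (P : R -> Prop) : (forall r, (/ 4 < r < / 2)%coqR -> P r) -> mostly P.
Proof. by move=> h; exists [::] => r hr _; apply: h. Qed.

Lemma mostly_and (P Q : R -> Prop) : mostly P -> mostly Q -> mostly (fun r => P r /\ Q r).
Proof.
move=> [l hl] [m hm]; exists (l ++ m) => r hr; rewrite mem_cat negb_or => /andP[nl nm].
by split; [apply: hl | apply: hm].
Qed.

Lemma mostly_imp (P Q : R -> Prop) : mostly P ->
  (forall r, (/ 4 < r < / 2)%coqR -> P r -> Q r) -> mostly Q.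
Proof. by move=> [l hl] PQ; exists l => r hr nl; apply: PQ => //; apply: hl. Qed.

Lemma mostly_ex (P : R -> Prop) : mostly P -> exists r, (/ 4 < r < / 2)%coqR /\ P r.
Proof.
move=> [l hl].
pose c (n : nat) : R := (/ 4 + / (8 + INR n))%coqR.
have c_inj : injective c.
  move=> m n /Rplus_eq_reg_l /Rinv_eq_reg /Rplus_eq_reg_l; exact: INR_eq.
have hc n : (/ 4 < c n < / 2)%coqR.
  have n0 := pos_INR n; have := Rinv_0_lt_compat (8 + INR n)%coqR.
  have : (/ (8 + INR n) <= / 8)%coqR by apply: Rinv_le_contravar; lra.
  by rewrite /c; lra.
have [n nl] : exists n, c n \notin l.
  apply: contrapT => h.
  have sub : {subset [seq c n | n <- seq.iota 0%nat (size l).+1] <= l}.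
    by move=> _ /mapP[n _ ->]; apply: contraT => nl; case: h; exists n.
  have := uniq_leq_size _ sub; rewrite map_inj_uniq // iota_uniq size_map size_iota ltnn.
  by move=> /(_ isT).
by exists (c n); split=> //; apply: hl.
Qed.

Lemma mostly_forall (T : finType) (P : T -> R -> Prop) :
  (forall i, mostly (P i)) -> mostly (fun r => forall i, P i r).
Proof.
move=> /choice[l hl]; exists (flatten [seq l i | i <- enum T]) => r hr nl i.
apply: hl => //; apply: contra nl => h.
by apply/flattenP; exists (l i) => //; apply: map_f; rewrite mem_enum.
Qed.

Lemma mostly_subgroup_gen (V : zmodType) (S : V -> Prop) (phi : R -> V -> R) :
  (forall r u v, phi r (u - v) = phi r u - phi r v) ->
  (forall u, S u -> mostly (fun r => phi r u = 0)) ->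
  forall u, subgroup_gen S u -> mostly (fun r => phi r u = 0).
Proof.
move=> phiB hS u; elim=> [{}u /hS //||{}u v _ hu _ hv].
  by apply: mostly_all => r _; have := phiB r 0 0; rewrite !subrr.
apply: mostly_imp (mostly_and hu hv) _ => r _ [eu ev].
by rewrite phiB eu ev subrr.
Qed.

Definition freeg_extend (T : choiceType) (f : T -> R) (s : {freeg T}) : R :=
  fglift (f : T -> zmodule R) s.

Lemma freeg_extendB (T : choiceType) (f : T -> R) (s t : {freeg T}) :
  freeg_extend f (s - t) = freeg_extend f s - freeg_extend f t.
Proof. exact: (lift_is_additive (f : T -> zmodule R) s t). Qed.

Lemma freeg_extend0 (T : choiceType) (f : T -> R) : freeg_extend f 0 = 0.
Proof. by have := freeg_extendB f 0 0; rewrite !subrr. Qed.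

Lemma freeg_extendD (T : choiceType) (f : T -> R) (s t : {freeg T}) :
  freeg_extend f (s + t) = freeg_extend f s + freeg_extend f t.
Proof. by rewrite -[t in LHS]opprK freeg_extendB -[- t]sub0r freeg_extendB freeg_extend0 sub0r opprK. Qed.

Lemma freeg_extendU (T : choiceType) (f : T -> R) (x : T) : freeg_extend f << x >> = f x.
Proof. by rewrite /freeg_extend liftU scale1r. Qed.

Lemma smooth_eval2 (F : fieldType) (phi : {rmorphism F -> C}) (X Y : R -> C) q :
  smooth X -> smooth Y -> smooth (fun t => eval2 phi (X t) (Y t) q).
Proof.
move=> sX sY; elim/poly_ind: q => [|q c IH].
  have -> : (fun t => eval2 phi (X t) (Y t) 0) = fun _ => 0.
    by apply: funext => t; rewrite eval20.
  exact: smooth_const.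
have -> : (fun t => eval2 phi (X t) (Y t) (q * 'X + c%:P))
    = (fun t => eval2 phi (X t) (Y t) q * Y t + (map_poly phi c).[X t]).
  by apply: funext => t; rewrite eval2D eval2M eval2_X eval2_polyC.
exact: smoothD (smoothM IH sY) (smooth_horner _ sX).
Qed.

(** [rep] chooses a fraction of polynomials for each element of L, and (X r, Y r) is a
loop on the curve for each radius r. *)
Section Specialization.
Variables (F L : fieldType) (iota : {rmorphism F -> L}) (x y : L) (f g : {poly F}).
Let p : {poly {poly F}} := 'X^2 + f%:P * 'X + g%:P.
Hypothesis ker : forall q, eval2 iota x y q = 0 <-> exists r, q = p * r.
Variable rep : L -> {poly {poly F}} * {poly {poly F}}.
Hypothesis repP : forall z, eval2 iota x y (rep z).2 != 0 /\
  z = eval2 iota x y (rep z).1 / eval2 iota x y (rep z).2.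
Variables (phi : {rmorphism F -> C}) (a : R) (Y : R -> R -> C).
Hypothesis HY : forall r, (/ 4 < r < / 2)%coqR -> [/\ punct (Y r), loop (Y r) &
  forall t, Y r t ^+ 2 + (map_poly phi f).[circle a r t] * Y r t
            + (map_poly phi g).[circle a r t] = 0].

Let X := circle a.
Let e r t (q : {poly {poly F}}) : C := eval2 phi (X r t) (Y r t) q.

Let e_ker r t q : (/ 4 < r < / 2)%coqR -> eval2 iota x y q = 0 -> e r t q = 0.
Proof.
move=> /HY[_ _ E] /ker[s ->]; rewrite /e eval2M /p eval2_quadratic E mul0r //.
Qed.

Let rep_mul z : z * eval2 iota x y (rep z).2 = eval2 iota x y (rep z).1.
Proof. by have [n2 {1}->] := repP z; rewrite divfK. Qed.

Definition value r (z : L) (t : R) : C := e r t (rep z).1 / e r t (rep z).2.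

Definition good r (z : L) : Prop := forall t, e r t (rep z).1 != 0 /\ e r t (rep z).2 != 0.

(** If q vanishes at (X r t, Y r t), then X r t is a root of the norm of q, and r is its
distance to the centre. *)
Lemma nonvanishing_mostly q : eval2 iota x y q != 0 -> mostly (fun r => forall t, e r t q != 0).
Proof.
move=> /(norm_exists ker)[N [c [d [nN eN]]]].
have nN' : map_poly phi N != 0 by rewrite map_poly_eq0.
have [rs ers] := closed_field_poly_normal (map_poly phi N).
exists [seq cabs (z - (a%:C)%C) | z <- rs] => r hr nr t.
apply/eqP => eq0; move/negP: nr; apply.
have : root (map_poly phi N) (X r t).
  have := congr1 (e r t) eN; rewrite /e eval2_polyC eval2D !eval2M.
  rewrite -/(e r t q) eq0 mul0r add0r /p eval2_quadratic.
  by have [_ _ ->] := HY hr; rewrite mul0r => h; apply/rootP.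
rewrite ers rootZ ?lead_coef_eq0 // root_prod_XsubC => h.
apply/mapP; exists (X r t) => //.
rewrite /X circle_shift Rminus_diag /cabs /circle /= !Rplus_0_l.
have := sin2_cos2 t; rewrite /Rsqr => hsc.
have -> : (r * cos t * (r * cos t) + r * sin t * (r * sin t))%coqR = (r * r)%coqR.
  have -> : (r * cos t * (r * cos t) + r * sin t * (r * sin t)
    = r * r * (sin t * sin t + cos t * cos t))%coqR by ring.
  by rewrite hsc; ring.
by rewrite sqrt_square //; lra.
Qed.

Lemma good_mostly z : z != 0 -> mostly (fun r => good r z).
Proof.
have [n2 ez] := repP z; move=> nz.
have n1 : eval2 iota x y (rep z).1 != 0.
  by apply: contraNneq nz => h; rewrite ez h mul0r.
apply: mostly_imp (mostly_and (nonvanishing_mostly n1) (nonvanishing_mostly n2)) _.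
by move=> r _ [h1 h2] t; split.
Qed.

Lemma value_punct r z : (/ 4 < r < / 2)%coqR -> good r z -> punct (value r z).
Proof.
move=> hr gz; have [[sY _] _ _] := HY hr.
have sX : smooth (X r) := C1c_smooth (circle_C1c a r).
split.
  apply: smoothM; first exact: smooth_eval2.
  by apply: smoothV; [exact: smooth_eval2 | move=> t; have [] := gz t].
by move=> t; have [h1 h2] := gz t; rewrite mulf_neq0 // invr_eq0.
Qed.

Lemma value_loop r z : (/ 4 < r < / 2)%coqR -> loop (value r z).
Proof. by move=> hr; have [_ lY _] := HY hr; rewrite /loop /value /e /X circle_loop lY. Qed.

(** Equal fractions in L have equal values on the loop, since a polynomial that is zero
in L is a multiple of p. *)
Lemma valueE r z q s t : (/ 4 < r < / 2)%coqR -> good r z ->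
  e r t s != 0 -> z * eval2 iota x y s = eval2 iota x y q ->
  value r z t = e r t q / e r t s.
Proof.
move=> hr gz ns E; have [_ h2] := gz t.
have K : eval2 iota x y ((rep z).1 * s - q * (rep z).2) = 0.
  rewrite eval2B !eval2M -E -(rep_mul z) (mulrAC z) subrr //.
apply/eqP; rewrite /value eqr_div // -subr_eq0.
by have := e_ker t hr K; rewrite /e eval2B !eval2M => ->.
Qed.

Lemma valueM r u v w t : (/ 4 < r < / 2)%coqR -> good r u -> good r v -> good r w ->
  w = u * v -> value r w t = value r u t * value r v t.
Proof.
move=> hr gu gv gw ew; rewrite /value mulf_div /e -!eval2M.
have [[_ h1] [_ h2]] := (gu t, gv t).
apply: valueE => //; first by rewrite /e eval2M mulf_neq0.
by rewrite ew !eval2M mulrACA !rep_mul.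
Qed.

Lemma value1B r u v t : (/ 4 < r < / 2)%coqR -> good r u -> good r v ->
  v = 1 - u -> value r v t = 1 - value r u t.
Proof.
move=> hr gu gv ev; have [_ h2] := gu t.
rewrite [in RHS]/value -(divff h2) -mulrBl /e -eval2B.
apply: valueE => //.
by rewrite ev eval2B mulrBl mul1r rep_mul.
Qed.

Lemma value_poly r z q t : (/ 4 < r < / 2)%coqR -> good r z ->
  z = eval2 iota x y q -> value r z t = e r t q.
Proof.
move=> hr gz ez; rewrite -[RHS]divr1 -(eval21 phi (X r t) (Y r t)).
apply: valueE => //; first by rewrite /e eval21 oner_neq0.
by rewrite eval21 mulr1.
Qed.

Definition reg_symbol r (uv : mulgrp L * mulgrp L) : R :=
  reg (value r (val uv.1)) (value r (val uv.2)).

Let good_val (u : mulgrp L) : mostly (fun r => good r (val u)).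
Proof. exact: good_mostly (valP u). Qed.

Lemma K2_relator_mostly s : K2_relator s -> mostly (fun r => freeg_extend (reg_symbol r) s = 0).
Proof.
case=> [u v w uv e1|u v w vw e1|u v e1].
- have := mostly_and (mostly_and (good_val u) (good_val v))
    (mostly_and (good_val w) (good_val uv)).
  move=> /mostly_imp; apply=> r hr [[gu gv] [gw guv]].
  rewrite !freeg_extendB !freeg_extendU /reg_symbol /=.
  have -> : value r (val uv) = fun t => value r (val u) t * value r (val v) t.
    by apply: funext => t; apply: valueM.
  rewrite regMl; [|exact: value_punct..].
  by apply/eqP; rewrite subr_eq0 subr_eq addrC.
- have := mostly_and (mostly_and (good_val u) (good_val v))
    (mostly_and (good_val w) (good_val vw)).
  move=> /mostly_imp; apply=> r hr [[gu gv] [gw gvw]].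
  rewrite !freeg_extendB !freeg_extendU /reg_symbol /=.
  have -> : value r (val vw) = fun t => value r (val v) t * value r (val w) t.
    by apply: funext => t; apply: valueM.
  rewrite regMr; [|exact: value_punct..].
  by apply/eqP; rewrite subr_eq0 subr_eq addrC.
- have := mostly_and (good_val u) (good_val v).
  move=> /mostly_imp; apply=> r hr [gu gv].
  rewrite freeg_extendU /reg_symbol /=.
  have e2 : value r (val v) = fun t => 1 - value r (val u) t.
    by apply: funext => t; apply: value1B.
  rewrite e2; apply: reg_steinberg; first exact: value_punct.
    by rewrite -e2; apply: value_punct.
  exact: value_loop.
Qed.

(** Depends on the representative, but two representatives give the same value for
most r. *)
Definition reg_K2 r (m : K2 L) : R := freeg_extend (reg_symbol r) (repr m).

Lemma reg_K2_pi s : mostly (fun r => reg_K2 r (\pi_(K2 L) s) = freeg_extend (reg_symbol r) s).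
Proof.
have : subgroup_gen (@K2_relator L) (repr (\pi_(K2 L) s) - s).
  by apply/zquot_relation; rewrite reprK.
move=> /(mostly_subgroup_gen (fun r => freeg_extendB (reg_symbol r)) K2_relator_mostly) h.
by apply: mostly_imp h _ => r _; rewrite freeg_extendB => /eqP; rewrite subr_eq0 => /eqP.
Qed.

Lemma reg_K2D m n : mostly (fun r => reg_K2 r (m + n) = reg_K2 r m + reg_K2 r n).
Proof.
have e1 : m + n = \pi_(K2 L) (repr m + repr n) by rewrite zquot_piD !reprK.
rewrite e1; apply: mostly_imp (reg_K2_pi (repr m + repr n)) _ => r _ ->.
exact: freeg_extendD.
Qed.

Definition reg_tensQ r : {freeg (K2 L * rat)} -> R :=
  freeg_extend (fun mq => ratr mq.2 * reg_K2 r mq.1).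

Lemma tensQ_relator_mostly s : tensQ_relator s -> mostly (fun r => reg_tensQ r s = 0).
Proof.
case=> [m n q|m q q'].
  apply: mostly_imp (reg_K2D m n) _ => r _ e1.
  rewrite /reg_tensQ !freeg_extendB !freeg_extendU /= e1 mulrDr.
  by apply/eqP; rewrite subr_eq0 subr_eq addrC.
apply: mostly_all => r _.
rewrite /reg_tensQ !freeg_extendB !freeg_extendU /= rmorphD mulrDl.
by apply/eqP; rewrite subr_eq0 subr_eq addrC.
Qed.

(** A linear relation in K_2 tensor Q is a relation between the regulators. *)
Lemma reg_relation n (u v : 'I_n -> L) (q : 'I_n -> rat) :
  (forall i, u i != 0) -> (forall i, v i != 0) ->
  \sum_i tens (symb (u i) (v i)) (q i) = 0 ->
  mostly (fun r => \sum_i ratr (q i) * reg (value r (u i)) (value r (v i)) = 0).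
Proof.
move=> nu nv; rewrite /tens -(big_morph _ (zquot_piD (@tensQ_relator (K2 L))) (zquot_pi0 _)) => E.
have : subgroup_gen (@tensQ_relator (K2 L))
   (\sum_i << (symb (u i) (v i), q i) >> - 0).
  by apply/zquot_relation; rewrite E zquot_pi0.
rewrite subr0 => /(mostly_subgroup_gen (fun r => freeg_extendB _) tensQ_relator_mostly) h.
have hs := mostly_forall (fun i =>
  reg_K2_pi << (to_mulgrp (u i), to_mulgrp (v i)) >>).
apply: mostly_imp (mostly_and h hs) _ => r _ [h1 h2].
rewrite -[RHS]h1 /reg_tensQ (big_morph _ (freeg_extendD _) (freeg_extend0 _)).
apply: eq_bigr => i _; rewrite freeg_extendU /= /symb h2 freeg_extendU /reg_symbol /= !insubdK //;
  [exact: nv | exact: nu].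
Qed.

End Specialization.

(** * Independence for large k *)

Lemma reg_error_gt0 : (0 < reg_error)%coqR.
Proof.
have := PI_RGT_0; have := ln4_pos; rewrite /reg_error => h1 h2.
by apply: Rmult_lt_0_compat; lra.
Qed.

Definition Qof_incl (k : C) : {rmorphism Qof k -> C} := (val : Qof k -> C).

Lemma family_branch fam (k : C) (a : R) : center a -> (20480000 < cabs k)%coqR ->
  exists Y : R -> R -> C, forall r, (/ 4 < r < / 2)%coqR -> [/\ punct (Y r), loop (Y r),
    forall t, Y r t ^+ 2 + (family_f k fam).[circle a r t] * Y r t
      + (family_g C fam).[circle a r t] = 0 &
    forall b, center b ->
      (Rabs (reg (circle (a - b) r) (Y r)
         + 2 * PI * ln (cabs k) * (if Req_dec_T (a - b) 0 then 1 else 0)) <= reg_error)%coqR].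
Proof.
move=> ca hk.
have nk : k != 0.
  by apply/eqP => k0; move: hk; rewrite k0 /cabs /= !Rmult_0_l Rplus_0_r sqrt_0; lra.
have nk' : - k != 0 by rewrite oppr_eq0.
have hs b : b \in fam_pts R fam -> (a - b = 0 \/ 1 <= Rabs (a - b) <= 2)%coqR.
  by move=> /fam_pts_center; apply: center_sub.
suff /choice[Y hY] : forall r, exists Y : R -> C, (/ 4 < r < / 2)%coqR ->
  [/\ punct Y, loop Y,
    forall t, Y t ^+ 2 + (family_f k fam).[circle a r t] * Y t
      + (family_g C fam).[circle a r t] = 0 &
    forall b, center b ->
      (Rabs (reg (circle (a - b) r) Y
         + 2 * PI * ln (cabs k) * (if Req_dec_T (a - b) 0 then 1 else 0)) <= reg_error)%coqR].
  by exists Y.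
move=> r; have [hr|hr] := pselect (/ 4 < r < / 2)%coqR; last by exists (fun _ => 0).
have [G [pG lG rG bG eG]] := branch_exists fam hr ca hk.
pose q t : C := \prod_(b <- fam_pts R fam) circle (a - b) r t.
have pq : punct q.
  by have [] := prod_circlele_reg (b := a) hr (or_introl (Rminus_diag_eq a a erefl)) hs.
exists (fun t => - k * (q t * G t)) => _; split.
- exact: punctM (punct_const nk') (punctM pq pG).
- rewrite /loop lG; congr (_ * (_ * _)).
  by apply: eq_bigr => b _; exact: circle_loop.
- exact: eG.
- move=> b cb; have s5 : leq (size (fam_pts R fam)) 5 by case: (fam).
  have := reg_asymptotics hr (center_sub ca cb) hs s5 nk' pG lG rG bG.
  rewrite lnabs_cabs // cabsN.
  have -> // : (ln (cabs k) * (if Req_dec_T (a - b) 0 then 2 * PI else 0)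
    = 2 * PI * ln (cabs k) * (if Req_dec_T (a - b) 0 then 1 else 0))%coqR.
  by destruct (Req_dec_T (a - b) 0); rewrite /=; ring.
Qed.

(** The points 0, 1, -1, in the order of the three symbols. *)
Definition base_pt (F : nzRingType) (i : 'I_3) : F := tnth [tuple 0; 1; -1] i.

Lemma base_pt_center i : center (base_pt R i).
Proof.
case: i => -[|[|[|//]]] lti; rewrite /base_pt (tnth_nth 0) /=.
- by left.
- by right; left.
- by right; right.
Qed.

Lemma base_pt_inj i j : base_pt R i = base_pt R j -> i = j.
Proof.
case: i => -[|[|[|//]]] lti; case: j => -[|[|[|//]]] ltj; rewrite /base_pt !(tnth_nth 0) /=;
  move=> e; try (by apply: val_inj); exfalso.
- by change (0 = 1)%coqR in e; lra.
- by change (0 = - 1)%coqR in e; lra.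
- by change (1 = 0)%coqR in e; lra.
- by change (1 = - 1)%coqR in e; lra.
- by change (- 1 = 0)%coqR in e; lra.
- by change (- 1 = 1)%coqR in e; lra.
Qed.

Lemma rmorph_base_pt (E F : nzRingType) (phi : {rmorphism E -> F}) i : phi (base_pt E i) = base_pt F i.
Proof.
by case: i => -[|[|[|//]]] lti; rewrite /base_pt !(tnth_nth 0) /= ?(rmorph0, rmorph1, rmorphN1).
Qed.

Lemma independence fam : exists B : R,
  forall (k : C) (L : fieldType) (iota : {rmorphism Qof k -> L}) (x y : L),
    (B%:C)%C < `|k| -> curve_Z fam iota x y ->
    Qindependent (tnth [tuple symb x y; symb (x - 1) y; symb (x + 1) y]).
Proof.
exists (Rmax 20480000 (exp reg_error)) => k L iota x y.
rewrite cabs_norm ltcR => /RltP hk cZ.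
have [nx nx1 nx2 ny] := curve_Z_neq0 cZ.
have hk1 : (20480000 < cabs k)%coqR by have := Rmax_l 20480000 (exp reg_error); lra.
have hk2 : (reg_error < ln (cabs k))%coqR.
  rewrite -(ln_exp reg_error); apply: ln_increasing; first exact: exp_pos.
  by have := Rmax_r 20480000 (exp reg_error); lra.
case: cZ => _ [ker frac] _.
have /choice[rep repP] : forall z : L, exists ab : {poly {poly Qof k}} * {poly {poly Qof k}},
    eval2 iota x y ab.2 != 0 /\ z = eval2 iota x y ab.1 / eval2 iota x y ab.2.
  by move=> z; have [a [b h]] := frac z; exists (a, b).
pose u i := x - base_pt L i.
have eu i : tnth [tuple symb x y; symb (x - 1) y; symb (x + 1) y] i = symb (u i) y.
  case: i => -[|[|[|//]]] lti; rewrite /u /base_pt !(tnth_nth 0) /=.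
  - by rewrite subr0.
  - by [].
  - by rewrite opprK.
have nu i : u i != 0.
  case: i => -[|[|[|//]]] lti; rewrite /u /base_pt (tnth_nth 0) /= ?subr0 ?opprK //.
move=> q; under eq_bigr do rewrite eu; move=> rel.
pose A := (2 * PI * ln (cabs k))%coqR.
have main i : exists E : 'I_3 -> R, \sum_j ratr (q j) * E j = 0 /\
    forall j, (Rabs (E j + A * (if Req_dec_T (base_pt R i - base_pt R j) 0 then 1 else 0)) <= reg_error)%coqR.
  have [Y hY] := family_branch fam (base_pt_center i) hk1.
  have HY r : (/ 4 < r < / 2)%coqR -> [/\ punct (Y r), loop (Y r) &
     forall t, Y r t ^+ 2
       + (map_poly (Qof_incl k) (family_f (Qgen k) fam)).[circle (base_pt R i) r t] * Y r t
       + (map_poly (Qof_incl k) (family_g (Qof k) fam)).[circle (base_pt R i) r t] = 0].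
    by move=> /hY[h1 h2 h3 _]; split=> // t; rewrite map_family_f map_family_g.
  have h := reg_relation ker repP HY nu (fun _ => ny) rel.
  have gu := mostly_forall (fun j => good_mostly ker repP HY (nu j)).
  have gy := good_mostly ker repP HY ny.
  have [r [hr [h0 [gur gyr]]]] := mostly_ex (mostly_and h (mostly_and gu gy)).
  exists (fun j => reg (circle (base_pt R i - base_pt R j) r) (Y r)); split; last first.
    by move=> j; have [_ _ _ h4] := hY r hr; apply: h4; exact: base_pt_center.
  rewrite -[RHS]h0; apply: eq_bigr => j _; congr (_ * reg _ _).
    apply: funext => t.
    have eu' : u j = eval2 iota x y ('X - (base_pt _ j)%:P)%:P.
      by rewrite eval2_polyC map_polyXsubC hornerXsubC rmorph_base_pt.
    rewrite (value_poly ker repP HY t hr (gur j) eu').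
    rewrite eval2_polyC map_polyXsubC hornerXsubC rmorph_base_pt.
    by rewrite -(rmorph_base_pt (real_complex R)) circle_shift.
  apply: funext => t.
  by rewrite (value_poly ker repP HY t hr gyr (q := 'X)) ?eval2_X.
have /choice[E hE] := main.
have Q0 := @near_scalar_injective Rdefinitions.R 3 A reg_error (fun j => ratr (q j)) E.
move=> i; have : ratr (q i) = 0 :> R; last by move/eqP; rewrite fmorph_eq0 => /eqP.
have pi3 : (3 < PI)%coqR by have := PI2_3_2; lra.
have rp := reg_error_gt0.
have hA : (3 * reg_error < A)%coqR by rewrite /A; nra.
apply: Q0.
- by apply/RleP; change (0 <= A)%coqR; lra.
- apply/RltP; rewrite -INRE [INR 3]/=.
  by have -> : (1 + 1 + 1 = 3)%coqR by ring.
- move=> j l; have [_ /(_ l)] := hE j; rewrite RabsE => /RleP; apply: le_trans.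
  have -> // : (j == l)%:R = (if Req_dec_T (base_pt R j - base_pt R l) 0 then 1 else 0)%coqR :> R.
  case: eqP => [->|n]; case: Req_dec_T => h //.
    by case: h; apply: Rminus_diag_eq.
  by case: n; apply: base_pt_inj; apply: Rminus_diag_uniq.
- by move=> j; have [] := hE j.
Qed.

(** * Residues at a place *)

From mathcomp Require Import ring zify.

Section Place.
Variables (F L : fieldType) (iota : {rmorphism F -> L}) (P : place iota).
Implicit Types (a b t x y z : L) (c : F) (q : {poly F}).
Local Notation van := (vanishes_at P).
Local Notation regular := (regular_at P).

Lemma ord1 : ord P 1 = 0.
Proof. by rewrite -(rmorph1 iota) ord_const. Qed.

Lemma ordN a : ord P (- a) = ord P a.
Proof.
have [->|a0] := eqVneq a 0; first by rewrite oppr0.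
by rewrite -mulN1r ordM ?oppr_eq0 ?oner_eq0 // -(rmorphN1 iota) ord_const add0r.
Qed.

Lemma ordV a : ord P a^-1 = - ord P a.
Proof.
have [->|a0] := eqVneq a 0; first by rewrite invr0 ord_zero oppr0.
by apply/eqP; rewrite -addr_eq0 -ordM ?invr_eq0 // mulVf // ord1.
Qed.

Lemma ordXn a n : ord P (a ^+ n) = n%:Z * ord P a.
Proof.
have [->|a0] := eqVneq a 0; first by rewrite expr0n ord_zero mulr0; case: n => [|n] /=; rewrite ?ord1 ?ord_zero.
elim: n => [|n IH]; first by rewrite expr0 ord1 mul0r.
by rewrite exprS ordM ?expf_neq0 // IH intS mulrDl mul1r.
Qed.

Lemma regularD a b : regular a -> regular b -> regular (a + b).
Proof.
rewrite /regular_at => ra rb.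
have [->|na] := eqVneq a 0; first by rewrite add0r.
have [->|nb] := eqVneq b 0; first by rewrite addr0.
have [->|nab] := eqVneq (a + b) 0; first by rewrite ord_zero.
by apply: le_trans (ordD P na nb nab); rewrite le_min ra.
Qed.

Lemma regularM a b : regular a -> regular b -> regular (a * b).
Proof.
rewrite /regular_at => ra rb.
have [->|na] := eqVneq a 0; first by rewrite mul0r ord_zero.
have [->|nb] := eqVneq b 0; first by rewrite mulr0 ord_zero.
by rewrite ordM // addr_ge0.
Qed.

Lemma regularN a : regular a -> regular (- a).
Proof. by rewrite /regular_at ordN. Qed.

Lemma regular_const c : regular (iota c).
Proof. by rewrite /regular_at ord_const. Qed.

Lemma van0 : van 0. Proof. by left. Qed.

Lemma vanN a : van a -> van (- a).
Proof. by case=> [->|h]; [left; rewrite oppr0 | right; rewrite ordN]. Qed.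

Lemma vanD a b : van a -> van b -> van (a + b).
Proof.
move=> [->|ha] [->|hb]; rewrite ?addr0 ?add0r; [by left | by right | by right |].
have [->|nab] := eqVneq (a + b) 0; [by left | right].
have na : a != 0 by apply: contraTneq ha => ->; rewrite ord_zero ltxx.
have nb : b != 0 by apply: contraTneq hb => ->; rewrite ord_zero ltxx.
by apply: lt_le_trans (ordD P na nb nab); rewrite lt_min ha.
Qed.

Lemma vanM a b : regular a -> van b -> van (a * b).
Proof.
rewrite /regular_at => ra [->|hb]; first by rewrite mulr0; left.
have [->|na] := eqVneq a 0; first by rewrite mul0r; left.
have nb : b != 0 by apply: contraTneq hb => ->; rewrite ord_zero ltxx.
by right; rewrite ordM // ltr_wpDl.
Qed.

Lemma vanX a n : van (a ^+ n) -> van a.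
Proof.
case=> [/eqP|]; first by rewrite expf_eq0 => /andP[_ /eqP ->]; left.
by rewrite ordXn => h; right; nia.
Qed.

Lemma unit_ord0 a : regular a -> ~ van a -> ord P a = 0.
Proof.
rewrite /regular_at => ra nva; apply/eqP; rewrite eq_le ra andbT leNgt.
by apply/negP => h; apply: nva; right.
Qed.

Definition res1 t := van (t - 1).

Lemma not_van1 : ~ van 1.
Proof. by case=> [/eqP|]; rewrite ?oner_eq0 ?ord1. Qed.

Lemma res1_regular t : res1 t -> regular t.
Proof.
move=> h; rewrite -[t](subrK 1); apply: regularD; last by rewrite /regular_at ord1.
by rewrite /regular_at; case: h => [->|/ltW //]; rewrite ord_zero.
Qed.

Lemma res1_ord t : res1 t -> ord P t = 0.
Proof.
move=> h; apply: unit_ord0; first exact: res1_regular.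
move=> /vanN ht; apply: not_van1; have := vanN (vanD h ht).
by rewrite (_ : - (t - 1 - t) = 1) //; ring.
Qed.

Lemma res1_neq0 t : res1 t -> t != 0.
Proof.
move=> h; apply/eqP => t0; apply: not_van1; have := vanN h.
by rewrite t0 sub0r opprK.
Qed.

Lemma res1M a b : res1 a -> res1 b -> res1 (a * b).
Proof.
move=> ha hb; rewrite /res1 (_ : _ - 1 = a * (b - 1) + (a - 1)); last by ring.
by apply: vanD => //; apply: vanM => //; apply: res1_regular.
Qed.

Lemma res1V t : res1 t -> res1 t^-1.
Proof.
move=> h; have nt := res1_neq0 h; rewrite /res1 (_ : _ - 1 = - t^-1 * (t - 1)); last by field.
by apply: vanM => //; rewrite /regular_at ordN ordV res1_ord.
Qed.

Lemma res1X t (n : int) : res1 t -> res1 (t ^ n).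
Proof.
move=> h; have X (m : nat) : res1 (t ^+ m).
  elim: m => [|m IH]; first by rewrite expr0 /res1 subrr; left.
  by rewrite exprS; apply: res1M.
by case: n => m; [exact: X | rewrite NegzE -invr_expz; apply: res1V; exact: X].
Qed.

(** The residue of [t] is 1 or -1. *)
Definition sign_res t := res1 (t ^+ 2).

Lemma sign_resM a b : sign_res a -> sign_res b -> sign_res (a * b).
Proof. by rewrite /sign_res exprMn; apply: res1M. Qed.

Lemma sign_resX t (n : int) : sign_res t -> sign_res (t ^ n).
Proof. by move=> /(res1X n); rewrite /sign_res !exprnP !exprz_exp mulrC. Qed.

Lemma sign_resV t : sign_res t -> sign_res t^-1.
Proof. by rewrite /sign_res exprVn; apply: res1V. Qed.

Lemma sign_res_ord t : sign_res t -> ord P t = 0.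
Proof. by move=> /res1_ord; rewrite ordXn => h; nia. Qed.

Lemma sign_res_van t (e : L) : e ^+ 2 = 1 -> regular t -> van (t + e) -> sign_res t.
Proof.
move=> e2 rt vt; rewrite /sign_res /res1 -e2 subr_sqr; apply: vanM => //.
have -> : t - e = (t + e) - (e + e) by ring.
have re : regular e.
  by rewrite /regular_at; have := ordXn e 2; rewrite e2 ord1; nia.
apply: regularD; last by apply: regularN; apply: regularD.
by rewrite /regular_at; case: vt => [->|/ltW //]; rewrite ord_zero.
Qed.

Lemma horner_regular q x : regular x -> regular (map_poly iota q).[x].
Proof.
move=> rx; elim/poly_ind: q => [|q c IH].
  by rewrite rmorph0 horner0 /regular_at ord_zero.
rewrite rmorphD rmorphM /= map_polyX map_polyC hornerMXaddC.
by apply: regularD; [apply: regularM | apply: regular_const].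
Qed.

Lemma horner_van q c x : regular x -> van (x - iota c) ->
  van ((map_poly iota q).[x] - iota q.[c]).
Proof.
move=> rx vx; have /factor_theorem[s es] : root (q - (q.[c])%:P) c.
  by apply/rootP; rewrite hornerD hornerN hornerC subrr.
have -> : (map_poly iota q).[x] - iota q.[c] = (map_poly iota (q - (q.[c])%:P)).[x].
  by rewrite rmorphB /= map_polyC hornerD hornerN hornerC.
rewrite es rmorphM /= map_polyXsubC hornerM hornerXsubC.
by apply: vanM => //; apply: horner_regular.
Qed.

End Place.

(** * Tameness *)

Definition fam_deg (fam : Zfamily) : nat := match fam with FamI _ => 5 | _ => 6 end.

Lemma family_gE (F : fieldType) fam : family_g F fam = 'X^(fam_deg fam).
Proof. by case: fam. Qed.

Lemma family_f_at0 (F : fieldType) (k : F) fam : (family_f k fam).[0] = 1.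
Proof. by rewrite family_fE /fam_h; case: fam => [s||s]; rewrite !big_cons big_nil; ring. Qed.

Lemma family_f_palindromic (F : fieldType) (k x : F) fam : x != 0 ->
  (family_f k fam).[x] = x ^+ fam_deg fam * (family_f k fam).[x^-1].
Proof.
move=> nx; rewrite !family_fE /fam_h.
by case: fam => [s||s]; rewrite !big_cons !big_nil; field.
Qed.

(** At a = 1 and a = -1 the equation for y is (y + e)^2 = 0 with e = 1 or -1, or
y^2 - 1 = 0. *)
Lemma family_double_root (F : fieldType) (k a : F) fam : a ^+ 2 = 1 ->
  (exists e : F, [/\ e ^+ 2 = 1, (family_f k fam).[a] = e + e & a ^+ fam_deg fam = 1])
  \/ (family_f k fam).[a] = 0 /\ a ^+ fam_deg fam = -1.
Proof.
move=> /eqP; rewrite sqrf_eq1 => /orP[] /eqP ->; rewrite family_fE /fam_h.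
  left; case: fam => [s||s]; rewrite !big_cons !big_nil !expr1n.
  - exists ((-1) ^+ s); split=> //; first by rewrite sqrr_sign.
    ring.
  - by exists 1; split=> //; [ring | ring].
  - exists (- (-1) ^+ s); split=> //; first by rewrite sqrrN sqrr_sign.
    ring.
case: fam => [s||s]; rewrite !big_cons !big_nil.
- by right; split; ring.
- by left; exists (-1); split; ring.
- left; exists (- (-1) ^+ s); split; [by rewrite sqrrN sqrr_sign | ring | ring].
Qed.

Section Tame.
Variables (F L : fieldType) (iota : {rmorphism F -> L}) (P : place iota) (k : F) (fam : Zfamily).
Local Notation van := (vanishes_at P).
Local Notation regular := (regular_at P).
Let f : {poly L} := family_f (iota k) fam.
Let n := fam_deg fam.
Definition on_Z (x y : L) : Prop := y ^+ 2 + f.[x] * y + x ^+ n = 0.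

Let f_regular x : regular x -> regular f.[x].
Proof. by rewrite /f -map_family_f; apply: horner_regular. Qed.

Let regularX x m : regular x -> regular (x ^+ m).
Proof. by rewrite /regular_at ordXn => rx; apply: mulr_ge0. Qed.

Let f_van (a : F) x : regular x -> van (x - iota a) -> van (f.[x] - f.[iota a]).
Proof.
by rewrite /f -map_family_f horner_map; apply: horner_van.
Qed.

(** y is integral over the ring generated by x. *)
Lemma on_Z_regular x y : on_Z x y -> regular x -> regular y.
Proof.
move=> E rx; rewrite /regular_at leNgt; apply/negP => hy.
have ny : y != 0 by apply: contraTneq hy => ->; rewrite ord_zero ltxx.
have e : 1 = - (f.[x] * y^-1 + x ^+ n * y^-1 ^+ 2).
  apply: (mulIf (expf_neq0 2 ny)); rewrite mul1r.
  have -> : - (f.[x] * y^-1 + x ^+ n * y^-1 ^+ 2) * y ^+ 2 = y ^+ 2 - (y ^+ 2 + f.[x] * y + x ^+ n) by field.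
  by rewrite E subr0.
have vy : van y^-1 by right; rewrite ordV oppr_gt0.
apply: (@not_van1 _ _ _ P); rewrite e; apply: vanN; apply: vanD.
  by apply: vanM => //; apply: f_regular.
have ry : regular y^-1 by rewrite /regular_at ordV oppr_ge0 ltW.
by rewrite expr2; apply: vanM; [apply: regularX | apply: vanM].
Qed.

Let sgn0 a : a != 0 -> sign_res P (a ^ 0).
Proof. by move=> _; rewrite expr0z /sign_res /res1 expr1n subrr; apply: van0. Qed.

(** The residue of y is 0 or -1. If it is -1, then y is a unit. Otherwise the conjugate
root has residue -1, and the product of the two roots is x^n. *)
Lemma tame_over_zero x y : x != 0 -> y != 0 -> on_Z x y -> 0 < ord P x ->
  sign_res P (x ^ ord P y / y ^ ord P x).
Proof.
move=> nx ny E hx.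
have rx : regular x by apply: ltW.
have ry := on_Z_regular E rx.
have vx : van x by right.
have vf : van (f.[x] - 1).
  have := @f_van 0 x rx; rewrite rmorph0 subr0 => /(_ vx).
  by rewrite {2}/f family_f_at0.
have vxn : van (x ^+ n).
  by right; rewrite ordXn pmulr_rgt0 //; rewrite /n; case: (fam).
have vy : van (y * (y + 1)).
  have -> : y * (y + 1) = (y ^+ 2 + f.[x] * y + x ^+ n) - (y * (f.[x] - 1) + x ^+ n) by ring.
  by rewrite E sub0r; apply: vanN; apply: vanD => //; apply: vanM.
have one2 : (1 : L) ^+ 2 = 1 by rewrite expr1n.
have [y0|y0] := eqVneq (ord P y) 0.
  rewrite y0 expr0z mul1r; apply: sign_resV; apply: sign_resX.
  apply: (sign_res_van one2) => //.
  have -> : y + 1 = y^-1 * (y * (y + 1)) by field.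
  by apply: vanM => //; rewrite /regular_at ordV y0.
have vy0 : van y by right; rewrite lt_neqAle eq_sym y0.
pose y' := - f.[x] - y.
have yy' : y * y' = x ^+ n.
  have -> : y * y' = x ^+ n - (y ^+ 2 + f.[x] * y + x ^+ n) by rewrite /y'; ring.
  by rewrite E subr0.
have s' : sign_res P y'.
  apply: (sign_res_van one2); first by apply: regularD; apply: regularN => //; apply: f_regular.
  have -> : y' + 1 = - ((f.[x] - 1) + y) by rewrite /y'; ring.
  by apply: vanN; apply: vanD.
have ny' : y' != 0 by apply: contraNneq (expf_neq0 n nx) => h; rewrite -yy' h mulr0.
have oy : ord P y = n%:Z * ord P x.
  by rewrite -ordXn -yy' ordM // (sign_res_ord s') addr0.
have -> : x ^ ord P y / y ^ ord P x = y' ^ ord P x.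
  rewrite oy -exprz_exp -exprnP -yy' expfzMl mulrAC divff ?mul1r //.
  exact: expfz_neq0.
exact: sign_resX.
Qed.

(** If x reduces to a, then y reduces to 1 or -1, by [family_double_root]. Over x = 0
the function x - a reduces to - a, and elsewhere x - a and y are units. *)
Lemma tame_over_finite (a : F) x y : a ^+ 2 = 1 -> y != 0 -> on_Z x y -> regular x ->
  x - iota a != 0 -> sign_res P ((x - iota a) ^ ord P y / y ^ ord P (x - iota a)).
Proof.
move=> a2 ny E rx nu.
have ia2 : iota a ^+ 2 = 1 by rewrite -rmorphXn /= a2 rmorph1.
have ry := on_Z_regular E rx.
have ra : regular (iota a) by apply: regular_const.
have ru : regular (x - iota a) by apply: regularD => //; apply: regularN.
have [hx|hx] := boolP (0 < ord P x).
  have su : sign_res P (x - iota a).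
    apply: (sign_res_van ia2) => //; rewrite subrK; by right.
  by rewrite (sign_res_ord su) expr0z divr1; apply: sign_resX.
have ox : ord P x = 0 by apply/eqP; rewrite eq_le rx andbT leNgt.
have [->|nx] := eqVneq x 0.
  have su : sign_res P (0 - iota a).
    by rewrite sub0r /sign_res sqrrN ia2 /res1 subrr; apply: van0.
  by rewrite (sign_res_ord su) expr0z divr1; apply: sign_resX.
have oy : ord P y = 0.
  apply: unit_ord0 => // vy.
  have : van (x ^+ n).
    have -> : x ^+ n = (y ^+ 2 + f.[x] * y + x ^+ n) - (y + f.[x]) * y by ring.
    rewrite E sub0r; apply: vanN; apply: vanM => //.
    by apply: regularD => //; apply: f_regular.
  move=> /vanX [/eqP|]; first by rewrite (negPf nx).
  by rewrite ox.
rewrite oy expr0z mul1r; apply: sign_resV.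
have [vu|vu] := pselect (van (x - iota a)); last first.
  by rewrite (unit_ord0 ru vu); apply: sgn0.
apply: sign_resX.
have vq : van (y ^+ 2 + f.[iota a] * y + iota a ^+ n).
  have v1 : van ((f.[x] - f.[iota a]) * y) by rewrite mulrC; apply: vanM => //; apply: f_van.
  have v2 : van (x ^+ n - iota a ^+ n).
    by rewrite subrXX mulrC; apply: vanM => //; elim/big_ind: _ => [|? ? |i _];
      [rewrite /regular_at ord_zero | apply: regularD | apply: regularM; apply: regularX].
  have -> : y ^+ 2 + f.[iota a] * y + iota a ^+ n
    = (y ^+ 2 + f.[x] * y + x ^+ n) - ((f.[x] - f.[iota a]) * y + (x ^+ n - iota a ^+ n)) by ring.
  by rewrite E sub0r; apply: vanN; apply: vanD.
have [[e [e2 ef en]]|[ef en]] := family_double_root (iota k) fam ia2.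
  apply: (sign_res_van e2) => //; apply: (@vanX _ _ _ _ _ 2).
  move: vq; rewrite /f ef en -e2; congr (van _); ring.
move: vq; rewrite /f ef en /sign_res /res1; congr (van _); ring.
Qed.

(** The symmetry that exchanges the points over x = 0 and over infinity. *)
Lemma on_Z_inv x y : x != 0 -> on_Z x y -> on_Z x^-1 (y / x ^+ n).
Proof.
move=> nx E; have nxn := expf_neq0 n nx; rewrite /on_Z.
have -> : (y / x ^+ n) ^+ 2 + f.[x^-1] * (y / x ^+ n) + x^-1 ^+ n
  = (y ^+ 2 + (x ^+ n * f.[x^-1]) * y + x ^+ n) / x ^+ n ^+ 2 by rewrite exprVn; field.
by rewrite -family_f_palindromic // E mul0r.
Qed.

(** At a pole of x, the point (1/x, w) with w = y / x^n lies over 0, and up to the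
function v = 1 - a / x, of residue 1, the symbol of (x - a, y) is the inverse of
that of (1/x, w). *)
Lemma tame_sign (a : F) x y : a = 0 \/ a ^+ 2 = 1 -> x != 0 -> y != 0 -> x - iota a != 0 ->
  on_Z x y -> sign_res P ((x - iota a) ^ ord P y / y ^ ord P (x - iota a)).
Proof.
move=> ha nx ny nu E; case: (ltrgtP (ord P x) 0) => hx; first last.
- case: ha => [a0|a2]; last by apply: tame_over_finite => //; rewrite /regular_at hx.
  rewrite a0 rmorph0 subr0 in nu *.
  have rx : regular x by rewrite /regular_at hx.
  have oy : ord P y = 0.
    apply: unit_ord0 => [|vy]; first exact: on_Z_regular E rx.
    have : van (x ^+ n).
      have -> : x ^+ n = (y ^+ 2 + f.[x] * y + x ^+ n) - (y + f.[x]) * y by ring.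
      rewrite E sub0r; apply: vanN; apply: vanM => //.
      by apply: regularD; [exact: on_Z_regular E rx | apply: f_regular].
    by move=> /vanX [/eqP|]; rewrite ?(negPf nx) // hx.
  by rewrite oy hx !expr0z divr1; rewrite -(expr0z x); apply: sgn0.
- case: ha => [a0|a2]; last by apply: tame_over_finite => //; apply: ltW.
  by rewrite a0 rmorph0 subr0; apply: tame_over_zero.
have nt : x^-1 != 0 by rewrite invr_eq0.
have nxn := expf_neq0 n nx.
pose w := y / x ^+ n.
have nw : w != 0 by rewrite mulf_neq0 ?invr_eq0.
have ht : 0 < ord P x^-1 by rewrite ordV oppr_gt0.
have T := tame_over_zero nt nw (on_Z_inv nx E) ht.
pose v := 1 - iota a * x^-1.
have rv : res1 P v.
  have -> : v = 1 - iota a * x^-1 by [].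
  rewrite /res1 addrAC subrr sub0r; apply: vanN; apply: vanM; first exact: regular_const.
  by right.
have uE : x - iota a = x * v by rewrite /v; field.
have nv := res1_neq0 rv.
have ou : ord P (x - iota a) = ord P x by rewrite uE ordM // (res1_ord rv) addr0.
have oy : ord P y = ord P w + n%:Z * ord P x.
  by rewrite -ordXn -ordM // /w divfK.
have -> : (x - iota a) ^ ord P y / y ^ ord P (x - iota a)
  = v ^ ord P y * (x^-1 ^ ord P w / w ^ ord P x^-1)^-1.
  rewrite ou uE expfzMl [x ^ _ * _]mulrC -mulrA; congr (_ * _).
  have yE : y = w * x ^+ n by rewrite /w divfK.
  have e1 : w ^ (- ord P x) = (w ^ ord P x)^-1 by rewrite invr_expz.
  have e2 : x^-1 ^ ord P w = (x ^ ord P w)^-1 by rewrite exprz_inv invr_expz.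
  have e3 : x ^ (n%:Z * ord P x) = (x ^+ n) ^ ord P x by rewrite -exprz_exp -exprnP.
  rewrite oy yE expfzMl expfzDr // ordV e1 e2 e3.
  by field; rewrite oner_neq0 !expfz_neq0.
apply: sign_resM; last exact: sign_resV.
by apply: sign_resX; rewrite /sign_res expr2; apply: res1M.
Qed.

End Tame.

Lemma symb_sqr (L : fieldType) (u y : L) : y != 0 ->
  symb u y + symb u y = symb u (y ^+ 2).
Proof.
move=> ny; rewrite -zquot_piD; apply/esym/zquot_relation; rewrite opprD addrA.
apply: subgroup_gen_in; apply: K2_mulr.
by rewrite !insubdK ?expr2 //; apply: mulf_neq0.
Qed.

(** m (x) 1 = (m + m) (x) 1/2. *)
Lemma inQspan_half (M : zmodType) (N : M -> Prop) (m : M) : N (m + m) -> inQspan N m.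
Proof.
move=> Nm; apply: subgroup_gen_in; exists (m + m), (1 / 2); split=> //.
have -> : tens (m + m) (1 / 2) = tens m (1 / 2) + tens m (1 / 2).
  rewrite -zquot_piD; apply/zquot_relation; rewrite opprD addrA.
  by apply: subgroup_gen_in; apply: tensQ_addl.
rewrite -zquot_piD; apply/zquot_relation; rewrite opprD addrA.
have -> : (1 : rat) = 1 / 2 + 1 / 2 by field.
by apply: subgroup_gen_in; apply: tensQ_addr.
Qed.

Lemma tame_freeg_symb (F L : fieldType) (iota : {rmorphism F -> L}) (P : place iota) (u y : L) :
  u != 0 -> y != 0 -> tame_freeg P << (to_mulgrp u, to_mulgrp y) >> = tame_fun P u y.
Proof.
move=> nu ny; rewrite /tame_freeg domU1 big_seq1 coeffU eqxx mulr1 expr1z /=.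
by rewrite !insubdK.
Qed.

Lemma tame_fun_sqr (F L : fieldType) (iota : {rmorphism F -> L}) (P : place iota) (u y : L) :
  tame_fun P u (y ^+ 2) = (u ^ ord P y / y ^ ord P u) ^+ 2.
Proof.
rewrite /tame_fun ordXn.
have -> : (-1 : L) ^ (ord P u * (2%:Z * ord P y)) = 1.
  by rewrite mulrCA -exprz_exp -exprnP sqrrN expr1n exp1rz.
have -> : u ^ (2%:Z * ord P y) = (u ^ ord P y) ^+ 2 by rewrite mulrC -exprz_exp -exprnP.
have -> : (y ^+ 2) ^ ord P u = (y ^ ord P u) ^+ 2 by rewrite !exprnP !exprz_exp mulrC.
by rewrite mul1r expr_div_n.
Qed.

Lemma inQspan_symb (F L : fieldType) (iota : {rmorphism F -> L}) (u y : L) :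
  u != 0 -> y != 0 ->
  (forall P : place iota, sign_res P (u ^ ord P y / y ^ ord P u)) ->
  inQspan (K2T iota) (symb u y).
Proof.
move=> nu ny h; apply: inQspan_half; rewrite symb_sqr // => P.
apply/tame_trivialP; rewrite tame_freeg_symb ?expf_neq0 // tame_fun_sqr.
exact: h.
Qed.

Lemma tameness fam (k : C) (L : fieldType) (iota : {rmorphism Qof k -> L}) (x y : L) :
  curve_Z fam iota x y ->
  [/\ inQspan (K2T iota) (symb x y), inQspan (K2T iota) (symb (x - 1) y) &
      inQspan (K2T iota) (symb (x + 1) y)].
Proof.
move=> cZ; have [nx nx1 nx2 ny] := curve_Z_neq0 cZ.
case: cZ => _ [ker _] _.
have E : on_Z iota (Qgen k) fam x y.
  have : eval2 iota x y (family_poly (Qgen k) fam) = 0 by apply/ker; exists 1; rewrite mulr1.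
  rewrite eval2_quadratic map_family_f family_gE map_polyXn.
  by rewrite hornerXn.
have T a : a = 0 \/ a ^+ 2 = 1 -> x - iota a != 0 -> inQspan (K2T iota) (symb (x - iota a) y).
  move=> ha nu; apply: inQspan_symb => // P; exact: tame_sign ha nx ny nu E.
split.
- by have := T 0; rewrite rmorph0 subr0; apply=> //; left.
- by have := T 1; rewrite rmorph1; apply=> //; right; rewrite expr1n.
- by have := T (-1); rewrite rmorphN1 opprK; apply=> //; right; rewrite sqrrN expr1n.
Qed.

Local Open Scope complex_scope.

Theorem mainTheorem2 (fam : Zfamily) :
  (forall (k : C) (L : fieldType) (iota : {rmorphism Qof k -> L}) (x y : L),
     curve_Z fam iota x y ->
     [/\ inQspan (K2T iota) (symb x y),
         inQspan (K2T iota) (symb (x - 1) y) &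
         inQspan (K2T iota) (symb (x + 1) y)]) /\
  (exists B : Rdefinitions.R,
     forall (k : C) (L : fieldType) (iota : {rmorphism Qof k -> L}) (x y : L),
       B%:C < `|k| ->
       curve_Z fam iota x y ->
       Qindependent
         (tnth [tuple symb x y; symb (x - 1) y; symb (x + 1) y])).
Proof. by split; [exact: tameness | exact: independence]. Qed.
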